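(* Let $\mathcal A,\mathcal B\in\mathbb{C}^{I_1\times\cdots\times I_N\times I_1\times\cdots\times I_N}$ be random Hermitian tensors and let $\mathcal X\in\mathbb{C}^{I_1\times\cdots\times I_N\times I_1\times\cdots\times I_N}$ be a Hermitian tensor. For two real numbers $\alpha,\beta$ such that $0\le\alpha,\beta\le1$, two positive integers $m,n$, and every $\theta>0$, we have $$\Pr\left(\left\|\mathcal A^{\frac{m(1+\alpha)}2}\star_N\mathcal X\star_N\mathcal B^{\frac{n(1-\alpha)}2}-\mathcal A^{\frac{m(1-\beta)}2}\star_N\mathcal X\star_N\mathcal B^{\frac{n(1+\beta)}2}\right\|\ge\theta\right)\le\frac{(\mathbb{I}_1^N)^2}{\theta}\left[\min_{c>0}\left(\sqrt{2c}\,\|g(t)\|_2+\sqrt{2/c}\,\|g'(t)\|_2\right)\right]\mathbb{E}\left(\left\|\mathcal A^m\star_N\mathcal X-\mathcal X\star_N\mathcal B^n\right\|\right),$$ where $$g(t)=\frac{\exp\left(\frac{\alpha t}2\right)-\exp\left(\frac{-\beta t}2\right)}{\exp\left(\frac t2\right)-\exp\left(\frac{-t}2\right)} .$$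
   Context: $\mathbb{I}_1^N=I_1\cdots I_N$. For square tensors the Einstein product is $(\mathcal X\star_N\mathcal Y)_{i_1\ldots i_N,k_1\ldots k_N}=\sum_{j_1,\ldots,j_N}x_{i_1\ldots i_N,j_1\ldots j_N}y_{j_1\ldots j_N,k_1\ldots k_N}$. Every Hermitian tensor has an eigen-decomposition $\mathcal H=\sum_{i=1}^{\mathbb{I}_1^N}\lambda_i\mathcal P_i$ with eigenvalues $\lambda_i$ and $\mathcal P_i=\mathcal U_i\star_1\mathcal U_i^H$, the $\mathcal U_i\in\mathbb{C}^{I_1\times\cdots\times I_N\times1}$ orthonormal; powers are understood through it, $\mathcal H^p=\sum_i\lambda_i^p\mathcal P_i$. $\|\cdot\|$ on tensors is the spectral norm (largest singular value); $\|\cdot\|_2$ on functions is the $L^2(\mathbb{R})$ norm; $g'$ is the derivative of $g$.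
   Formalization: The random Hermitian tensors A and B are additionally assumed to have nonnegative eigenvalues; otherwise real powers are undefined and the claim fails (A = -Id, B = X = Id, m = n = 4, α = 1/2, β = 0). *)

(* Defs.v *)
From HB Require Import structures.
From mathcomp Require Import all_boot all_order all_algebra.
From mathcomp Require Import complex.
From mathcomp Require Import all_classical all_reals all_analysis.

Set Implicit Arguments.
Unset Strict Implicit.
Unset Printing Implicit Defensive.

Import Order.TTheory GRing.Theory Num.Theory.
Import numFieldNormedType.Exports.

Local Open Scope classical_set_scope.
Local Open Scope ring_scope.
Local Open Scope complex_scope.

Definition midx (N : nat) (I : 'I_N -> nat) : finType :=
  {dffun forall k : 'I_N, 'I_(I k)}.

(* C^(I_1 x ... x I_N x J_1 x ... x J_M); an entry is addressed by a pair of
   multi-indices. *)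
Definition tensor (R : realType) (N M : nat)
    (I : 'I_N -> nat) (J : 'I_M -> nat) : choiceType :=
  {ffun midx I * midx J -> R[i]}.

(* C^(I_1 x ... x I_N x 1) *)
Definition vtensor (R : realType) (N : nat) (I : 'I_N -> nat) : choiceType :=
  tensor R I (fun _ : 'I_1 => 1%N).

Definition tsub (R : realType) (N M : nat) (I : 'I_N -> nat) (J : 'I_M -> nat)
    (X Y : tensor R I J) : tensor R I J :=
  [ffun p => X p - Y p].

(* The Einstein product, contracting all the modes J_1, ..., J_M. *)
Definition einstein (R : realType) (N M L : nat)
    (I : 'I_N -> nat) (J : 'I_M -> nat) (K : 'I_L -> nat)
    (X : tensor R I J) (Y : tensor R J K) : tensor R I K :=
  [ffun p => \sum_(j : midx J) X (p.1, j) * Y (j, p.2)].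

Definition ctranspose (R : realType) (N M : nat)
    (I : 'I_N -> nat) (J : 'I_M -> nat) (X : tensor R I J) : tensor R J I :=
  [ffun p => (X (p.2, p.1))^*%R].

Definition hermitian_tensor (R : realType) (N : nat) (I : 'I_N -> nat)
    (H : tensor R I I) : Prop :=
  ctranspose H = H.

Definition teigenvalue (R : realType) (N : nat) (I : 'I_N -> nat)
    (H : tensor R I I) (a : R) : Prop :=
  exists2 U : vtensor R I,
    (exists p, U p != 0) & einstein H U = [ffun p => a%:C * U p].

Definition orthonormal_family (R : realType) (N : nat) (I : 'I_N -> nat)
    (n : nat) (U : 'I_n -> vtensor R I) : Prop :=
  forall i j, einstein (ctranspose (U i)) (U j) = [ffun=> (i == j)%:R].

(* sum_i w_i U_i * U_i^H *)
Definition spectral_sum (R : realType) (N : nat) (I : 'I_N -> nat)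
    (n : nat) (w : 'I_n -> R) (U : 'I_n -> vtensor R I) : tensor R I I :=
  [ffun p => \sum_(i < n) (w i)%:C * einstein (U i) (ctranspose (U i)) p].

Definition eigen_decomposition (R : realType) (N : nat) (I : 'I_N -> nat)
    (H : tensor R I I) (lam : 'I_(\prod_(k < N) I k)%N -> R)
    (U : 'I_(\prod_(k < N) I k)%N -> vtensor R I) : Prop :=
  orthonormal_family U /\ H = spectral_sum lam U.

(* H^p = sum_i lambda_i^p P_i, read off an eigen-decomposition of H; the value
   does not depend on the decomposition chosen. With [powR] this is meant for
   nonnegative eigenvalues and p >= 0, with 0^0 = 1. *)
Definition tpow (R : realType) (N : nat) (I : 'I_N -> nat)
    (H : tensor R I I) (p : R) : tensor R I I :=
  xget [ffun=> 0] [set K : tensor R I I | exists lam U,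
    eigen_decomposition H lam U /\
    K = spectral_sum (fun i => lam i `^ p) U].

Definition singular_value (R : realType) (N : nat) (I : 'I_N -> nat)
    (X : tensor R I I) (s : R) : Prop :=
  0 <= s /\ teigenvalue (einstein (ctranspose X) X) (s ^+ 2).

(* The set is finite, and nonempty for positive dimensions, so that its
   supremum is the largest singular value. *)
Definition tnorm (R : realType) (N : nat) (I : 'I_N -> nat)
    (X : tensor R I I) : R :=
  sup [set s | singular_value X s].

Definition random_tensor (d : measure_display) (Omega : measurableType d)
    (R : realType) (N : nat) (I : 'I_N -> nat)
    (A : Omega -> tensor R I I) : Prop :=
  forall p, measurable_fun [set: Omega] (fun w => complex.Re (A w p)) /\
            measurable_fun [set: Omega] (fun w => complex.Im (A w p)).

(* The quotient has a removable singularity at 0, where it tends to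
   (alpha + beta) / 2. *)
Definition gfun (R : realType) (alpha beta : R) (t : R) : R :=
  if t == 0 then (alpha + beta) / 2
  else (expR (alpha * t / 2) - expR (- beta * t / 2))
       / (expR (t / 2) - expR (- t / 2)).

(* Valued in \bar R: infinite when f is not square integrable. *)
Definition L2norm (R : realType) (f : R -> R) : \bar R :=
  'N[@lebesgue_measure R]_2%:E[EFin \o f]%E.

Definition is_min (R : realType) (S : set (\bar R)) (v : \bar R) : Prop :=
  S v /\ lbound S v.

(* Main.v *)
Require Import Defs.
From HB Require Import structures.
From mathcomp Require Import all_boot all_order all_algebra.
From mathcomp Require Import complex.
From mathcomp Require Import all_classical all_reals all_analysis.
From mathcomp Require Import measurable_realfun ring lra.

(** Write a = lambda_i^m and b = mu_j^n for the eigenvalues of A^m and B^n. In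
    eigenbases of A and B, the (i, j) entry of A^m X - X B^n is (a - b) x_ij, and
    that of
      Z = A^(m(1+alpha)/2) X B^(n(1-alpha)/2) - A^(m(1-beta)/2) X B^(n(1+beta)/2)
    is q(a, b) x_ij, where for a, b > 0 one computes q(a, b) = g(t) (a - b) with
    t = ln (a / b). So Z is an entrywise multiple of Y = A^m X - X B^n, and a
    bound K / 2 for |g| off the origin gives |q(a, b)| <= K |a - b| for all
    a, b >= 0 (heinz_scalar_bound). The Frobenius norm is unitarily invariant and
    lies between the spectral norm and sqrt D times it, where D is the dimension;
    hence ||Z|| <= K sqrt D ||Y|| (heinz_tensor_bound), and sqrt D <= D^2.

    It remains to bound g by the constant of the theorem, and to apply Markov's
    inequality. Put u = ||g||_2 and v = ||g'||_2. The minimum over c is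
    sqrt (8 u v) when u and v are finite (agm_min). Integrating (g^2)' = 2 g g'
    from t towards infinity, on the side that avoids the removable singularity,
    gives g(t)^2 <= 2 u v (agmon), that is |g| <= K / 2 with K = sqrt (8 u v).
    If u or v is infinite then so is the constant, and only the case E ||Y|| = 0
    has content; there the elementary bound |g| <= 1 suffices.

    Markov's inequality needs the event to be measurable. The spectral norm is
    handled through the traces tr (Z^H Z)^k, which lie between ||Z||^(2k) and
    D ||Z||^(2k): ||Z|| >= theta iff tr (Z^H Z)^k >= theta^(2k) for every k
    (tnorm_geP). Real powers of a random positive tensor are measurable because
    they are pointwise limits of Bernstein polynomials (mxmeasurable_powR). *)

Set Implicit Arguments.
Unset Strict Implicit.
Unset Printing Implicit Defensive.

Import Order.TTheory GRing.Theory Num.Theory.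
Import numFieldNormedType.Exports.

Local Open Scope classical_set_scope.
Local Open Scope ring_scope.

(** * Unitary diagonalization *)

Section SpectralMatrices.
Local Open Scope complex_scope.
Local Open Scope sesquilinear_scope.
Variable R : realType.

(** The columns of V are the eigenvectors and f lists the eigenvalues in the same
    order, so that a function of the matrix is obtained by composing with f. *)
Definition spectral_mx n (V : 'M[R[i]]_n) (f : 'I_n -> R) : 'M[R[i]]_n :=
  V *m diag_mx (\row_j (f j)%:C) *m V^t*.

Lemma unitary_mulVmx n (V : 'M[R[i]]_n) : V \is unitarymx -> V^t* *m V = 1%:M.
Proof. by move=> /unitarymxP /mulmx1C. Qed.

Lemma adjmxM m n p (A : 'M[R[i]]_(m, n)) (B : 'M[R[i]]_(n, p)) :
  (A *m B)^t* = B^t* *m A^t*.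
Proof. by rewrite trmx_mul map_mxM. Qed.

Lemma spectral_mxE n (V : 'M[R[i]]_n) f i j :
  spectral_mx V f i j = \sum_l (f l)%:C * (V i l * (V j l)^*%R).
Proof.
rewrite /spectral_mx mul_mx_diag !mxE; apply: eq_bigr => l _.
by rewrite !mxE mulrAC mulrC.
Qed.

Lemma spectral_mx1 n (V : 'M[R[i]]_n) : V \is unitarymx ->
  spectral_mx V (fun=> 1) = 1%:M.
Proof.
move=> Vu; rewrite /spectral_mx (_ : \row__ _ = const_mx 1); last first.
  by apply/rowP => j; rewrite !mxE.
by rewrite diag_const_mx mulmx1; apply/unitarymxP.
Qed.

Lemma spectral_mxM n (V : 'M[R[i]]_n) f g : V \is unitarymx ->
  spectral_mx V f *m spectral_mx V g = spectral_mx V (fun j => f j * g j).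
Proof.
move=> Vu; rewrite /spectral_mx !mulmxA -(mulmxA _ _ V) unitary_mulVmx// mulmx1.
rewrite -(mulmxA V) mulmx_diag; congr (_ *m diag_mx _ *m _).
by apply/rowP => j; rewrite !mxE rmorphM.
Qed.

Lemma spectral_mxX n (V : 'M[R[i]]_n) f k : V \is unitarymx ->
  spectral_mx V f ^+ k = spectral_mx V (fun j => f j ^+ k).
Proof.
move=> Vu; elim: k => [|k IH]; first exact: esym (spectral_mx1 Vu).
rewrite exprS IH [LHS](spectral_mxM _ _ Vu); congr (spectral_mx _ _).
by apply/funext => j; rewrite exprS.
Qed.

Lemma spectral_mxZ n (V : 'M[R[i]]_n) f c :
  c%:C *: spectral_mx V f = spectral_mx V (fun j => c * f j).
Proof.
apply/matrixP => i j; rewrite mxE !spectral_mxE mulr_sumr.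
by apply: eq_bigr => l _; rewrite rmorphM mulrA.
Qed.

Lemma spectral_mxD n (V : 'M[R[i]]_n) f g :
  spectral_mx V f + spectral_mx V g = spectral_mx V (fun j => f j + g j).
Proof.
apply/matrixP => i j; rewrite mxE !spectral_mxE -big_split.
by apply: eq_bigr => l _; rewrite rmorphD mulrDl.
Qed.

Lemma mxtrace_spectral n (V : 'M[R[i]]_n) f : V \is unitarymx ->
  \tr (spectral_mx V f) = (\sum_j f j)%:C.
Proof.
move=> Vu; rewrite /spectral_mx mxtrace_mulC mulmxA unitary_mulVmx// mul1mx.
by rewrite mxtrace_diag rmorph_sum; apply: eq_bigr => j _; rewrite mxE.
Qed.

Lemma hermitian_spectral n (A : 'M[R[i]]_n) : A^t* = A ->
  exists2 V, V \is unitarymx & exists f, A = spectral_mx V f.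
Proof.
move=> hA; have Ah : A \is hermsymmx.
  by apply/is_hermitianmxP; rewrite expr0 scale1r hA.
have An := hermitian_normalmx Ah.
have Pu := spectral_unitarymx A.
have A_eq : A = (spectralmx A)^t* *m diag_mx (spectral_diag A) *m spectralmx A.
  by rewrite -(invmx_unitary Pu); apply/orthomx_spectralP.
exists ((spectralmx A)^t*); first by rewrite trmxC_unitary.
exists (fun j => complex.Re (spectral_diag A 0 j)).
rewrite /spectral_mx trmxCK [LHS]A_eq.
congr (_ *m diag_mx _ *m _); apply/rowP => j; rewrite mxE.
have /mxOverP/(_ 0 j) := hermitian_spectral_diag_real Ah.
by move=> /complex_realP[k ->].
Qed.

Lemma spectral_mx_eigenvalue n (V : 'M[R[i]]_n) f a (v : 'cV[R[i]]_n) :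
  V \is unitarymx -> v != 0 -> spectral_mx V f *m v = a%:C *: v ->
  exists j, a = f j.
Proof.
move=> Vu v0 Av.
have Vv0 : V^t* *m v != 0.
  apply: contraNneq v0 => V0; rewrite -[v]mul1mx -(unitarymxP Vu).
  by rewrite -mulmxA V0 mulmx0.
have DVv : diag_mx (\row_j (f j)%:C) *m (V^t* *m v) = a%:C *: (V^t* *m v).
  rewrite scalemxAr -Av /spectral_mx -!mulmxA (mulmxA _ V).
  by rewrite (unitary_mulVmx Vu) mul1mx.
have [j vj] : exists j, (V^t* *m v) j 0 != 0.
  apply/existsP; apply: contraNT Vv0; rewrite negb_exists => /forallP h.
  by apply/eqP/colP => j; have := h j; rewrite negbK [RHS]mxE => /eqP.
exists j; move/matrixP/(_ j 0): DVv; rewrite mul_diag_mx mxE [RHS]mxE mxE.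
by move/(mulIf vj)/complexI.
Qed.

Lemma spectral_mx_eigenvector n (V : 'M[R[i]]_n) f j : V \is unitarymx ->
  col j V != 0 /\ spectral_mx V f *m col j V = (f j)%:C *: col j V.
Proof.
move=> Vu; have VjE : V^t* *m col j V = delta_mx j 0.
  by rewrite colE mulmxA unitary_mulVmx// mul1mx.
split.
  apply/eqP => Vj0; move: VjE; rewrite Vj0 mulmx0 => /matrixP/(_ j 0).
  by rewrite !mxE !eqxx => /esym/eqP; rewrite oner_eq0.
rewrite /spectral_mx -!mulmxA VjE mul_diag_mx.
rewrite (_ : (\matrix_(_, _) _) = (f j)%:C *: delta_mx j 0); last first.
  apply/colP => l; rewrite !mxE eqxx andbT; case: eqVneq => [->//|_].
  by rewrite !mulr0.
by rewrite -scalemxAr -colE.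
Qed.

Lemma diag_intertwine n (T : 'M[R[i]]_n) (h k : 'I_n -> R) :
  diag_mx (\row_j (k j)%:C) *m T = T *m diag_mx (\row_j (h j)%:C) <->
  forall i j, (k i)%:C * T i j = T i j * (h j)%:C.
Proof.
rewrite mul_diag_mx mul_mx_diag; split => [/matrixP H i j|H].
  by have := H i j; rewrite !mxE.
by apply/matrixP => i j; have := H i j; rewrite !mxE.
Qed.

(** The change of basis T = W^* V between two diagonalizations of one matrix
    satisfies g i * T i j = T i j * f j, so it is supported on the pairs of equal
    eigenvalues, and there any function of the eigenvalues may be inserted. *)
Lemma spectral_mx_fun n (V W : 'M[R[i]]_n) f g (phi : R -> R) :
  V \is unitarymx -> W \is unitarymx -> spectral_mx V f = spectral_mx W g ->
  spectral_mx V (phi \o f) = spectral_mx W (phi \o g).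
Proof.
move=> Vu Wu E; pose T := W^t* *m V.
have intertwine h k : spectral_mx V h = spectral_mx W k <->
    forall i j, (k i)%:C * T i j = T i j * (h j)%:C.
  apply: iff_trans (diag_intertwine _ _ _); split => H.
    have HV : spectral_mx V h *m V = V *m diag_mx (\row_j (h j)%:C).
      by rewrite /spectral_mx -(mulmxA _ _ V) (unitary_mulVmx Vu) mulmx1.
    have WH : W^t* *m spectral_mx W k = diag_mx (\row_j (k j)%:C) *m W^t*.
      by rewrite /spectral_mx -(mulmxA W) (mulmxA _ W) (unitary_mulVmx Wu) mul1mx.
    by rewrite /T mulmxA -WH -mulmxA -H mulmxA -(mulmxA _ V) -HV mulmxA.
  have VT : V = W *m T by rewrite /T mulmxA (unitarymxP Wu) mul1mx.
  have TT : T *m T^t* = 1%:M.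
    rewrite /T adjmxM trmxCK mulmxA -(mulmxA _ V) (unitarymxP Vu) mulmx1.
    exact: unitary_mulVmx.
  clearbody T; rewrite /spectral_mx VT adjmxM -!mulmxA (mulmxA T) -H -!mulmxA.
  by rewrite (mulmxA T (T^t*)) TT mul1mx.
apply/intertwine => i j; have /intertwine/(_ i j) := E.
have [->|Tij] := eqVneq (T i j) 0; first by move=> _; rewrite mul0r mulr0.
by rewrite mulrC => /(mulfI Tij)/complexI /= ->; rewrite mulrC.
Qed.

Lemma gram_spectral_ge0 n (X : 'M[R[i]]_n) V f : V \is unitarymx ->
  X^t* *m X = spectral_mx V f -> forall j, 0 <= f j.
Proof.
move=> Vu E j; rewrite -ler0c.
have : (X *m V)^t* *m (X *m V) = diag_mx (\row_j (f j)%:C).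
  rewrite adjmxM mulmxA -(mulmxA _ _ X) E /spectral_mx.
  by rewrite -!mulmxA unitary_mulVmx// mulmx1 mulmxA unitary_mulVmx// mul1mx.
move=> /matrixP/(_ j j) Ej.
have -> : (f j)%:C = ((X *m V)^t* *m (X *m V)) j j.
  by rewrite Ej !mxE eqxx mulr1n.
by rewrite mxE; apply: sumr_ge0 => l _; rewrite !mxE mulrC mul_conjC_ge0.
Qed.

Lemma mxtrace_gramE m n (X : 'M[R[i]]_(m, n)) :
  \tr (X^t* *m X) = \sum_i \sum_j `|X i j| ^+ 2.
Proof.
rewrite exchange_big; apply: eq_bigr => j _; rewrite mxE.
by apply: eq_bigr => i _; rewrite !mxE normCKC.
Qed.

(** The Frobenius norm is unitarily invariant, and in the bases U and V the
    matrix Z is an entrywise multiple of Y: this is where a Schur multiplier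
    costs no more than its largest entry. *)
Lemma mxtrace_gram_multiplier n (U V Y Z : 'M[R[i]]_n) (r : 'I_n -> 'I_n -> R)
    (K : R) : U \is unitarymx -> V \is unitarymx ->
  (forall i j, (U^t* *m Z *m V) i j = (r i j)%:C * (U^t* *m Y *m V) i j) ->
  (forall i j, `|r i j| <= K) ->
  \tr (Z^t* *m Z) <= (K ^+ 2)%:C * \tr (Y^t* *m Y).
Proof.
move=> Uu Vu E rK.
have inv (X : 'M[R[i]]_n) : \tr (X^t* *m X)
    = \tr ((U^t* *m X *m V)^t* *m (U^t* *m X *m V)).
  rewrite !adjmxM trmxCK !mulmxA -(mulmxA _ U) (unitarymxP Uu) mulmx1.
  by rewrite [RHS]mxtrace_mulC !mulmxA (unitarymxP Vu) mul1mx.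
rewrite inv (inv Y) !mxtrace_gramE mulr_sumr; apply: ler_sum => i _.
rewrite mulr_sumr; apply: ler_sum => j _; rewrite E normrM exprMn.
apply: ler_wpM2r; first by rewrite exprn_ge0.
rewrite -normrX -rmorphXn normc_def /= expr0n addr0 sqrtr_sqr lecR.
rewrite normrX ler_sqr ?nnegrE ?rK//; exact: le_trans (rK i j).
Qed.

End SpectralMatrices.

(** * Tensors as matrices and the spectral norm *)

Section TensorsAsMatrices.
Local Open Scope complex_scope.
Local Open Scope sesquilinear_scope.
Variables (R : realType) (N : nat) (I : 'I_N -> nat).
Local Notation D := (\prod_(k < N) I k)%N.

Lemma card_midx : #|midx I| = D.
Proof.
by rewrite card_dep_ffun foldrE big_map big_enum; apply: eq_bigr => k _; rewrite card_ord.
Qed.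

Definition midx_of_ord (i : 'I_D) : midx I :=
  enum_val (cast_ord (esym card_midx) i).

Definition ord_of_midx (p : midx I) : 'I_D := cast_ord card_midx (enum_rank p).

Lemma midx_of_ordK : cancel midx_of_ord ord_of_midx.
Proof. by move=> i; rewrite /ord_of_midx enum_valK cast_ordKV. Qed.

Lemma ord_of_midxK : cancel ord_of_midx midx_of_ord.
Proof. by move=> p; rewrite /midx_of_ord cast_ordK enum_rankK. Qed.

Lemma sum_midx (F : midx I -> R[i]) :
  \sum_(p : midx I) F p = \sum_(i < D) F (midx_of_ord i).
Proof.
by apply: reindex; apply: onW_bij; exists ord_of_midx;
  [exact: midx_of_ordK | exact: ord_of_midxK].
Qed.

Definition tmx (X : tensor R I I) : 'M[R[i]]_D :=
  \matrix_(i, j) X (midx_of_ord i, midx_of_ord j).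

(** The column index of a tensor in C^(I_1 x ... x I_N x 1). *)
Definition midx1 : midx (fun _ : 'I_1 => 1%N) := [ffun=> ord0].

Lemma midx1_unique (p : midx (fun _ : 'I_1 => 1%N)) : p = midx1.
Proof. by apply/ffunP => k; rewrite ffunE [LHS]ord1. Qed.

Lemma sum_midx1 (F : midx (fun _ : 'I_1 => 1%N) -> R[i]) :
  \sum_p F p = F midx1.
Proof.
rewrite (bigD1 midx1)//= big1 ?addr0// => p.
by rewrite (midx1_unique p) eqxx.
Qed.

Definition vtmx (U : vtensor R I) : 'cV[R[i]]_D :=
  \col_i U (midx_of_ord i, midx1).

Definition vtensor_of (v : 'cV[R[i]]_D) : vtensor R I :=
  [ffun p => v (ord_of_midx p.1) 0].

Lemma vtensor_ofK v : vtmx (vtensor_of v) = v.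
Proof. by apply/colP => i; rewrite mxE ffunE midx_of_ordK. Qed.

Lemma tmx_inj : injective tmx.
Proof.
move=> X Y XY; apply/ffunP => -[p q].
have /matrixP/(_ (ord_of_midx p) (ord_of_midx q)) := XY.
by rewrite !mxE !ord_of_midxK.
Qed.

Lemma vtmx_inj : injective vtmx.
Proof.
move=> X Y XY; apply/ffunP => -[p q]; rewrite (midx1_unique q).
have /colP/(_ (ord_of_midx p)) := XY.
by rewrite !mxE !ord_of_midxK.
Qed.

Lemma tmx_einstein X Y : tmx (einstein X Y) = tmx X *m tmx Y.
Proof.
apply/matrixP => i j; rewrite !mxE ffunE sum_midx.
by apply: eq_bigr => l _; rewrite !mxE.
Qed.

Lemma vtmx_einstein X (U : vtensor R I) : vtmx (einstein X U) = tmx X *m vtmx U.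
Proof.
apply/colP => i; rewrite !mxE ffunE sum_midx.
by apply: eq_bigr => l _; rewrite !mxE.
Qed.

Lemma tmx_ctranspose X : tmx (ctranspose X) = (tmx X)^t*.
Proof. by apply/matrixP => i j; rewrite !mxE ffunE. Qed.

Lemma tmx_tsub X Y : tmx (tsub X Y) = tmx X - tmx Y.
Proof. by apply/matrixP => i j; rewrite !mxE ffunE. Qed.

Lemma teigenvalueP (X : tensor R I I) a : teigenvalue X a <->
  exists2 v : 'cV_D, v != 0 & tmx X *m v = a%:C *: v.
Proof.
have scal (U : vtensor R I) :
    vtmx ([ffun p => a%:C * U p] : vtensor R I) = a%:C *: vtmx U.
  by apply/colP => i; rewrite !mxE ffunE.
split => [[U [p Up] XU]|[v v0 Xv]].
  exists (vtmx U); last by rewrite -scal -XU vtmx_einstein.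
  apply: contraNneq Up => /colP/(_ (ord_of_midx p.1)).
  by rewrite !mxE ord_of_midxK -(midx1_unique p.2) -surjective_pairing => ->.
exists (vtensor_of v).
  apply: contrapT => /forallNP U0; case/negP: v0; apply/eqP/colP => i.
  have := U0 (midx_of_ord i, midx1); rewrite ffunE midx_of_ordK /= [RHS]mxE.
  by move=> /negP; rewrite negbK => /eqP.
by apply: vtmx_inj; rewrite scal vtmx_einstein vtensor_ofK.
Qed.

Definition basis_mx (U : 'I_D -> vtensor R I) : 'M[R[i]]_D :=
  \matrix_(i, j) U j (midx_of_ord i, midx1).

Lemma orthonormal_basis_mx U : orthonormal_family U <-> basis_mx U \is unitarymx.
Proof.
have gram i j p : einstein (ctranspose (U i)) (U j) p
    = ((basis_mx U)^t* *m basis_mx U) i j.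
  rewrite ffunE sum_midx mxE (midx1_unique p.1) (midx1_unique p.2).
  by apply: eq_bigr => l _; rewrite !mxE ffunE.
split => [oU|/unitary_mulVmx Vu i j].
  apply/unitarymxP/mulmx1C/matrixP => i j.
  by rewrite -(gram i j (midx1, midx1)) oU ffunE mxE.
by apply/ffunP => p; rewrite gram Vu ffunE mxE.
Qed.

Lemma tmx_spectral_sum (w : 'I_D -> R) U :
  tmx (spectral_sum w U) = spectral_mx (basis_mx U) w.
Proof.
apply/matrixP => i j; rewrite spectral_mxE mxE ffunE; apply: eq_bigr => l _.
by rewrite ffunE sum_midx1 !mxE ffunE.
Qed.

Lemma eigen_decompositionP (H : tensor R I I) lam U :
  eigen_decomposition H lam U <->
  basis_mx U \is unitarymx /\ tmx H = spectral_mx (basis_mx U) lam.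
Proof.
rewrite /eigen_decomposition -tmx_spectral_sum.
by split=> -[/orthonormal_basis_mx ? E]; split=> //; [rewrite E|exact: tmx_inj].
Qed.

Lemma basis_mx_vtensor V : basis_mx (fun j => vtensor_of (col j V)) = V.
Proof. by apply/matrixP => i j; rewrite !mxE ffunE midx_of_ordK mxE. Qed.

Lemma hermitian_tensorP (H : tensor R I I) :
  hermitian_tensor H <-> (tmx H)^t* = tmx H.
Proof.
rewrite /hermitian_tensor -tmx_ctranspose.
by split => [->//|/tmx_inj].
Qed.

(** By spectral_mx_fun the power does not depend on the decomposition of H, so
    that a single basis diagonalizes all the powers of H. *)
Lemma tmx_tpow (H : tensor R I I) V lam p : V \is unitarymx ->
  tmx H = spectral_mx V lam ->
  tmx (tpow H p) = spectral_mx V (fun j => lam j `^ p).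
Proof.
move=> Vu HV; rewrite /tpow; case: xgetP => [K _ [mu [U [HU ->]]]|noK].
  have [Uu HUE] := (eigen_decompositionP _ _ _).1 HU.
  rewrite tmx_spectral_sum.
  by apply: (spectral_mx_fun (fun x => x `^ p) Uu Vu); rewrite -HUE.
have := noK (spectral_sum (fun j => lam j `^ p) (fun j => vtensor_of (col j V))).
case; exists lam, (fun j => vtensor_of (col j V)); split=> //.
by apply/eigen_decompositionP; rewrite basis_mx_vtensor.
Qed.

Lemma tspectral_ge0 (H : tensor R I I) V lam : V \is unitarymx ->
  tmx H = spectral_mx V lam -> (forall a, teigenvalue H a -> 0 <= a) ->
  forall j, 0 <= lam j.
Proof.
move=> Vu HV H0 j; apply: H0; apply/teigenvalueP; exists (col j V).
  by have [] := spectral_mx_eigenvector lam j Vu.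
by rewrite HV; have [] := spectral_mx_eigenvector lam j Vu.
Qed.

(** The supremum in the definition of the spectral norm is attained, because the
    eigenvalues of X^H X are finitely many and nonnegative. *)
Lemma tnorm_max (X : tensor R I I) V f : (0 < D)%N -> V \is unitarymx ->
  (tmx X)^t* *m tmx X = spectral_mx V f ->
  exists2 j, tnorm X = Num.sqrt (f j) & forall l, f l <= f j.
Proof.
move=> D_gt0 Vu E; have f0 := gram_spectral_ge0 Vu E.
have [j jmax] : exists j, forall l, f l <= f j.
  have [j _ jmax] := @arg_maxP _ _ _ (Ordinal D_gt0) xpredT f isT.
  by exists j => l; exact: jmax.
exists j => //.
have GE : tmx (einstein (ctranspose X) X) = spectral_mx V f.
  by rewrite tmx_einstein tmx_ctranspose.
have Sj : singular_value X (Num.sqrt (f j)).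
  split; first exact: sqrtr_ge0.
  apply/teigenvalueP; exists (col j V).
    by have [] := spectral_mx_eigenvector f j Vu.
  by rewrite sqr_sqrtr// GE; have [] := spectral_mx_eigenvector f j Vu.
have Sub : ubound [set s | singular_value X s] (Num.sqrt (f j)).
  move=> s [s0 /teigenvalueP[v v0]]; rewrite GE.
  move=> /(spectral_mx_eigenvalue Vu v0)[l sl].
  by rewrite -(ger0_norm s0) -sqrtr_sqr ler_wsqrtr// sl.
apply/le_anti/andP; split; first by apply: ge_sup => //; exists (Num.sqrt (f j)).
by apply: ub_le_sup => //; exists (Num.sqrt (f j)).
Qed.

Lemma gram_spectral (X : 'M[R[i]]_D) :
  exists2 V, V \is unitarymx & exists f, X^t* *m X = spectral_mx V f.
Proof. by apply: hermitian_spectral; rewrite adjmxM trmxCK. Qed.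

Lemma tnorm_ge0 (X : tensor R I I) : (0 < D)%N -> 0 <= tnorm X.
Proof.
move=> D_gt0; have [V Vu [f E]] := gram_spectral (tmx X).
by have [j -> _] := tnorm_max D_gt0 Vu E; exact: sqrtr_ge0.
Qed.

(** The trace of (X^H X)^k is the sum of the 2k-th powers of the singular
    values, among which the largest is the spectral norm. *)
Lemma tnorm_trace (X : tensor R I I) k : (0 < D)%N ->
  let t := complex.Re (\tr (((tmx X)^t* *m tmx X) ^+ k)) in
  tnorm X ^+ (2 * k) <= t <= D%:R * tnorm X ^+ (2 * k).
Proof.
move=> D_gt0 /=.
have [V Vu [f E]] := gram_spectral (tmx X).
have f0 := gram_spectral_ge0 Vu E.
have [j -> jmax] := tnorm_max D_gt0 Vu E.
rewrite E (spectral_mxX _ _ Vu) (mxtrace_spectral _ Vu) /= exprM sqr_sqrtr//.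
apply/andP; split.
  by rewrite (bigD1 j)//= lerDl sumr_ge0// => l _; rewrite exprn_ge0.
rewrite mulr_natl -[X in _ *+ X]card_ord -sumr_const; apply: ler_sum => l _.
by apply: lerXn2r; rewrite ?nnegrE.
Qed.

End TensorsAsMatrices.

(** * Bernstein polynomials *)

Section Bernstein.
Variable R : realType.
Implicit Types (x : R) (n : nat) (phi psi : nat -> R).

(** The mean of phi over the number of successes in n independent trials of
    probability x, conditioning on one trial at a time. As a function of x it is
    a Bernstein polynomial; in this form it makes sense for a matrix x too. *)
Fixpoint bernstein x n phi : R :=
  if n is n'.+1
  then (1 - x) * bernstein x n' phi + x * bernstein x n' (phi \o succn)
  else phi 0%N.

Lemma bernstein_le x n phi psi : 0 <= x <= 1 ->
  (forall k, (k <= n)%N -> phi k <= psi k) ->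
  bernstein x n phi <= bernstein x n psi.
Proof.
move=> /andP[x0 x1]; elim: n phi psi => [|n IH] phi psi le /=; first exact: le.
apply: lerD; apply: ler_wpM2l; rewrite ?subr_ge0//; apply: IH => k kn.
  by apply: le; rewrite leqW.
exact: le.
Qed.

Lemma bernstein_affine x n a b phi :
  bernstein x n (fun k => a + b * phi k) = a + b * bernstein x n phi.
Proof.
elim: n phi => [//|n IH] phi /=.
by rewrite IH (IH (phi \o succn)); ring.
Qed.

Lemma bernstein_variance x n c :
  bernstein x n (fun k => (k%:R - c) ^+ 2)
  = n%:R * x * (1 - x) + (n%:R * x - c) ^+ 2.
Proof.
elim: n c => [|n IH] c /=; first by ring.
rewrite IH (_ : _ \o _ = fun k => (k%:R - (c - 1)) ^+ 2); last first.
  by apply/funext => k /=; rewrite -natr1; ring.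
by rewrite IH -natr1; ring.
Qed.

(** Chebyshev's inequality for the binomial law: an error quadratic in the
    distance to x is averaged to a multiple of the variance x (1 - x) / n. *)
Lemma bernstein_quadratic (f : R -> R) x n e K : 0 <= x <= 1 -> 0 <= K ->
  (0 < n)%N ->
  (forall y, 0 <= y <= 1 -> `|f y - f x| <= e + K * (y - x) ^+ 2) ->
  `|bernstein x n (fun k => f (k%:R / n%:R)) - f x| <= e + K / n%:R.
Proof.
move=> x01 K0 n0 fx; have n0' : n%:R != 0 :> R by rewrite pnatr_eq0 -lt0n.
pose q k : R := (k%:R - n%:R * x) ^+ 2.
have qE k : (k%:R / n%:R - x) ^+ 2 = q k / n%:R ^+ 2 by rewrite /q; field.
have le k : (k <= n)%N -> `|f (k%:R / n%:R) - f x| <= e + K / n%:R ^+ 2 * q k.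
  move=> kn; rewrite mulrAC -mulrA -qE; apply: fx; rewrite divr_ge0//=.
  by rewrite ler_pdivrMr ?ltr0n// mul1r ler_nat.
have v : K / n%:R ^+ 2 * bernstein x n q <= K / n%:R.
  rewrite bernstein_variance subrr expr0n addr0.
  have -> : K / n%:R ^+ 2 * (n%:R * x * (1 - x)) = K / n%:R * (x * (1 - x)).
    by field.
  rewrite ler_piMr ?divr_ge0//; move/andP: x01 => [x0 x1].
  by rewrite mulr_ile1 ?subr_ge0// gerBl.
rewrite ler_distl; apply/andP; split.
  rewrite lerBlDr.
  suff : (f x - e) + (- (K / n%:R ^+ 2)) * bernstein x n q
      <= bernstein x n (fun k => f (k%:R / n%:R)) by move: v; lra.
  rewrite -bernstein_affine; apply: bernstein_le => // k /le.
  by rewrite ler_distl => /andP[+ _]; lra.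
suff : bernstein x n (fun k => f (k%:R / n%:R))
    <= (f x + e) + (K / n%:R ^+ 2) * bernstein x n q by move: v; lra.
rewrite -bernstein_affine; apply: bernstein_le => // k /le.
by rewrite ler_distl => /andP[_ +]; lra.
Qed.

(** Away from x the error is at most 2, which is dominated by a multiple of
    (y - x)^2; so continuity at the single point x suffices. *)
Lemma bernstein_cvg (f : R -> R) x : 0 <= x <= 1 ->
  (forall y, 0 <= y <= 1 -> `|f y| <= 1) ->
  (forall e, 0 < e -> exists2 d, 0 < d &
    forall y, 0 <= y <= 1 -> `|y - x| < d -> `|f y - f x| <= e) ->
  bernstein x n (fun k => f (k%:R / n%:R)) @[n --> \oo] --> f x.
Proof.
move=> x01 f1 fx; apply/cvgrPdist_le => e e0.
have [d d0 fd] := fx (e / 2) ltac:(lra).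
pose K := 2 / d ^+ 2.
have K0 : 0 <= K by rewrite divr_ge0// exprn_ge0// ltW.
have quad y : 0 <= y <= 1 -> `|f y - f x| <= e / 2 + K * (y - x) ^+ 2.
  move=> y01; have [yd|yd] := ltP `|y - x| d.
    apply: le_trans (fd _ y01 yd) _.
    by rewrite lerDl mulr_ge0// sqr_ge0.
  have : 2 <= K * (y - x) ^+ 2.
    rewrite /K mulrAC ler_pdivlMr ?exprn_gt0// ler_pM2l//.
    by rewrite -[leRHS]real_normK ?num_real// lerXn2r// ?nnegrE ltW.
  have := f1 _ y01; have := f1 _ x01; have := ler_normB (f y) (f x).
  by move=> ? ? ? ?; lra.
have [n0 n0K] : exists n0, K / (e / 2) < n0%:R.
  by exists (Num.Def.truncn (K / (e / 2))).+1; rewrite Num.Theory.truncnS_gt.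
exists (n0.+1) => // n /= nn0; have n_gt0 : (0 < n)%N by exact: leq_trans nn0.
rewrite distrC; apply: le_trans (bernstein_quadratic x01 K0 n_gt0 quad) _.
suff : K / n%:R <= e / 2 by lra.
rewrite ler_pdivrMr ?ltr0n// mulrC -ler_pdivrMr; last by lra.
apply: le_trans (ltW n0K) _; rewrite ler_nat; exact: ltnW.
Qed.

Lemma powR_near (p x : R) : 0 <= p -> 0 <= x -> forall e, 0 < e ->
  exists2 d, 0 < d &
    forall y, 0 <= y -> `|y - x| < d -> `|y `^ p - x `^ p| <= e.
Proof.
rewrite le_eqVlt => /predU1P[<- _ e e0|p0].
  by exists 1 => // y _ _; rewrite !powRr0 subrr normr0 ltW.
rewrite le_eqVlt => /predU1P[<- e e0|x0 e e0].
  exists (e `^ p^-1); first exact: powR_gt0.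
  move=> y y0; rewrite !subr0 powR0 ?gt_eqF// subr0 ger0_norm// => ye.
  rewrite ger0_norm ?powR_ge0//.
  have -> : e = (e `^ p^-1) `^ p.
    by rewrite -powRrM mulVf ?gt_eqF// powRr1// ltW.
  by apply: ge0_ler_powR; rewrite ?nnegrE ?powR_ge0// ltW.
have : {for x, continuous (fun y : R => y `^ p)}.
  apply/differentiable_continuous/derivable1_diffP.
  by apply: derivable_powR; rewrite in_itv/= x0.
move=> /cvgrPdist_le/(_ e e0) [d /= d0 xd]; exists d => // y _ yx.
by rewrite distrC; apply: xd => /=; rewrite distrC.
Qed.

End Bernstein.

(** * Measurable random matrices *)

Section ComplexMeasurability.
Local Open Scope complex_scope.
Local Open Scope sesquilinear_scope.
Variables (R : realType) (d : measure_display) (T : measurableType d).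

Definition cmeasurable (f : T -> R[i]) : Prop :=
  measurable_fun [set: T] (fun w => complex.Re (f w)) /\
  measurable_fun [set: T] (fun w => complex.Im (f w)).

Lemma cmeasurable_real (f : T -> R) : measurable_fun [set: T] f ->
  cmeasurable (fun w => (f w)%:C).
Proof. by move=> mf; split => //; exact: measurable_cst. Qed.

Lemma cmeasurable_cst (c : R[i]) : cmeasurable (fun=> c).
Proof. by split; exact: measurable_cst. Qed.

Lemma cmeasurableD f g : cmeasurable f -> cmeasurable g ->
  cmeasurable (fun w => f w + g w).
Proof.
move=> [f1 f2] [g1 g2]; split.
  apply: eq_measurable_fun (measurable_funD f1 g1) => w _ /=.
  by case: (f w) (g w) => [? ?] [].
apply: eq_measurable_fun (measurable_funD f2 g2) => w _ /=.
by case: (f w) (g w) => [? ?] [].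
Qed.

Lemma cmeasurableM f g : cmeasurable f -> cmeasurable g ->
  cmeasurable (fun w => f w * g w).
Proof.
move=> [f1 f2] [g1 g2]; split.
  apply: eq_measurable_fun
    (measurable_funB (measurable_funM f1 g1) (measurable_funM f2 g2)) => w _ /=.
  by case: (f w) (g w) => [? ?] [].
apply: eq_measurable_fun
  (measurable_funD (measurable_funM f1 g2) (measurable_funM f2 g1)) => w _ /=.
by case: (f w) (g w) => [? ?] [].
Qed.

Lemma cmeasurable_sum (J : Type) (s : seq J) (f : J -> T -> R[i]) :
  (forall j, cmeasurable (f j)) -> cmeasurable (fun w => \sum_(j <- s) f j w).
Proof.
move=> mf; elim: s => [|j s IH].
  under eq_fun do rewrite big_nil; exact: cmeasurable_cst.
under eq_fun do rewrite big_cons; exact: cmeasurableD.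
Qed.

Lemma cmeasurable_conj f : cmeasurable f -> cmeasurable (fun w => (f w)^*%R).
Proof.
move=> [f1 f2]; split.
  by apply: eq_measurable_fun f1 => w _; case: (f w).
by apply: eq_measurable_fun (measurable_funN f2) => w _ /=; case: (f w).
Qed.

Definition mxmeasurable m n (M : T -> 'M[R[i]]_(m, n)) : Prop :=
  forall i j, cmeasurable (fun w => M w i j).

Lemma mxmeasurable_cst m n (M : 'M[R[i]]_(m, n)) : mxmeasurable (fun=> M).
Proof. by move=> i j; exact: cmeasurable_cst. Qed.

Lemma mxmeasurableD m n (M M' : T -> 'M[R[i]]_(m, n)) :
  mxmeasurable M -> mxmeasurable M' -> mxmeasurable (fun w => M w + M' w).
Proof.
move=> mM mM' i j; under eq_fun do rewrite mxE; exact: cmeasurableD.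
Qed.

Lemma mxmeasurableZ m n (c : T -> R[i]) (M : T -> 'M[R[i]]_(m, n)) :
  cmeasurable c -> mxmeasurable M -> mxmeasurable (fun w => c w *: M w).
Proof.
move=> mc mM i j; under eq_fun do rewrite mxE; exact: cmeasurableM.
Qed.

Lemma mxmeasurableB m n (M M' : T -> 'M[R[i]]_(m, n)) :
  mxmeasurable M -> mxmeasurable M' -> mxmeasurable (fun w => M w - M' w).
Proof.
move=> mM mM'; under eq_fun do rewrite -scaleN1r.
by apply: mxmeasurableD => //; apply: mxmeasurableZ => //; exact: cmeasurable_cst.
Qed.

Lemma mxmeasurableM m n p (M : T -> 'M[R[i]]_(m, n)) (M' : T -> 'M[R[i]]_(n, p)) :
  mxmeasurable M -> mxmeasurable M' -> mxmeasurable (fun w => M w *m M' w).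
Proof.
move=> mM mM' i j; under eq_fun do rewrite mxE.
by apply: cmeasurable_sum => l; exact: cmeasurableM.
Qed.

Lemma mxmeasurable_adj m n (M : T -> 'M[R[i]]_(m, n)) :
  mxmeasurable M -> mxmeasurable (fun w => (M w)^t*).
Proof.
move=> mM i j; under eq_fun do rewrite !mxE; exact: cmeasurable_conj.
Qed.

Lemma mxmeasurableX n (M : T -> 'M[R[i]]_n) k :
  mxmeasurable M -> mxmeasurable (fun w => M w ^+ k).
Proof.
move=> mM; elim: k => [|k IH]; first exact: mxmeasurable_cst.
by under eq_fun do rewrite exprS; exact: mxmeasurableM.
Qed.

Lemma cmeasurable_mxtrace n (M : T -> 'M[R[i]]_n) :
  mxmeasurable M -> cmeasurable (fun w => \tr (M w)).
Proof. by move=> mM; apply: cmeasurable_sum => i. Qed.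

End ComplexMeasurability.

Section MeasurablePowers.
Local Open Scope complex_scope.
Local Open Scope sesquilinear_scope.
Variable R : realType.

Fixpoint bernstein_mx n (H : 'M[R[i]]_n) k (phi : nat -> R) : 'M[R[i]]_n :=
  if k is k'.+1
  then (1%:M - H) *m bernstein_mx H k' phi
       + H *m bernstein_mx H k' (phi \o succn)
  else (phi 0%N)%:C *: 1%:M.

Lemma bernstein_spectral n (V : 'M[R[i]]_n) f k phi : V \is unitarymx ->
  bernstein_mx (spectral_mx V f) k phi
  = spectral_mx V (fun j => bernstein (f j) k phi).
Proof.
move=> Vu; elim: k phi => [|k IH] phi /=.
  rewrite -(spectral_mx1 Vu) spectral_mxZ; congr spectral_mx.
  by apply/funext => j; rewrite mulr1.
rewrite !IH -(spectral_mx1 Vu) -[- spectral_mx V f]scaleN1r.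
have -> : (-1 : R[i]) = (-1)%:C by rewrite rmorphN1.
rewrite spectral_mxZ spectral_mxD !(spectral_mxM _ _ Vu) spectral_mxD.
by congr spectral_mx; apply/funext => j; rewrite mulN1r.
Qed.

Lemma Re_spectral_mx n (V : 'M[R[i]]_n) f i j :
  complex.Re (spectral_mx V f i j)
  = \sum_l complex.Re (V i l * (V j l)^*%R) * f l.
Proof.
rewrite spectral_mxE (raddf_sum (@complex.Re R : Rcomplex R -> R)).
by apply: eq_bigr => l _; case: (V i l * _) => a b /=; ring.
Qed.

Lemma Im_spectral_mx n (V : 'M[R[i]]_n) f i j :
  complex.Im (spectral_mx V f i j)
  = \sum_l complex.Im (V i l * (V j l)^*%R) * f l.
Proof.
rewrite spectral_mxE (raddf_sum (@complex.Im R : Rcomplex R -> R)).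
by apply: eq_bigr => l _; case: (V i l * _) => a b /=; ring.
Qed.

Lemma cvg_linear_comb (J : Type) (s : seq J) (c : J -> R) (u : J -> R^nat)
    (l : J -> R) : (forall j, u j @ \oo --> l j) ->
  (fun n => \sum_(j <- s) c j * u j n) @ \oo --> \sum_(j <- s) c j * l j.
Proof.
move=> ul; elim: s => [|j s IH].
  under eq_fun do rewrite big_nil; rewrite big_nil; exact: cvg_cst.
under eq_fun do rewrite big_cons; rewrite big_cons.
by apply: cvgD IH; apply: cvgM (ul j); exact: cvg_cst.
Qed.

Variables (d : measure_display) (T : measurableType d).

Lemma mxmeasurable_bernstein n (H : T -> 'M[R[i]]_n) k phi :
  mxmeasurable H -> mxmeasurable (fun w => bernstein_mx (H w) k phi).
Proof.
move=> mH; elim: k phi => [|k IH] phi /=; first exact: mxmeasurable_cst.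
apply: mxmeasurableD; apply: mxmeasurableM => //.
by apply: mxmeasurableB => //; exact: mxmeasurable_cst.
Qed.

(** A power of H is a limit of polynomials in H. Since the spectrum of H lies in
    [0, 1 + tr H], the matrix H / (1 + tr H), still measurable, has its spectrum
    in [0, 1], and there the Bernstein polynomials of t^p converge pointwise. *)
Lemma mxmeasurable_powR n (H K : T -> 'M[R[i]]_n) p : 0 <= p ->
  mxmeasurable H ->
  (forall w, exists2 V, V \is unitarymx & exists2 f, forall j, 0 <= f j &
     H w = spectral_mx V f /\ K w = spectral_mx V (fun j => f j `^ p)) ->
  mxmeasurable K.
Proof.
move=> p0 mH HK; pose t w : R := 1 + complex.Re (\tr (H w)).
have mt : measurable_fun [set: T] t.
  apply: measurable_funD; first exact: measurable_cst.
  by have [] := cmeasurable_mxtrace mH.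
pose H' w := (t w `^ (-1))%:C *: H w.
have mH' : mxmeasurable H'.
  apply: mxmeasurableZ => //; apply: cmeasurable_real.
  exact: (measurableT_comp (measurable_powR _) mt).
pose B k w := (t w `^ p)%:C *: bernstein_mx (H' w) k (fun l => (l%:R / k%:R) `^ p).
have mB k : mxmeasurable (B k).
  apply: mxmeasurableZ; last exact: mxmeasurable_bernstein.
  by apply: cmeasurable_real; exact: (measurableT_comp (measurable_powR _) mt).
have cvgB w : exists2 V : 'M[R[i]]_n, True &
    exists u : 'I_n -> R^nat, exists f, [/\ K w = spectral_mx V f,
      forall k, B k w = spectral_mx V (fun j => u j k) &
      forall j, u j @ \oo --> f j].
  have [V Vu [f f0 [HV KV]]] := HK w.
  have tE : t w = 1 + \sum_j f j by rewrite /t HV (mxtrace_spectral _ Vu).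
  have t0 : 0 < t w by rewrite tE ltr_pwDl// sumr_ge0.
  have ft j : f j <= t w.
    by rewrite tE (bigD1 j)//= addrCA lerDl addr_ge0// sumr_ge0.
  exists V => //.
  exists (fun j k => t w `^ p *
      bernstein (t w `^ (-1) * f j) k (fun l => (l%:R / k%:R) `^ p)).
  exists (fun j => f j `^ p); split => // [k|j].
    by rewrite /B /H' HV spectral_mxZ bernstein_spectral// spectral_mxZ.
  have tV : t w `^ (-1) = (t w)^-1 by rewrite powR_inv1// ltW.
  have x0 : 0 <= t w `^ (-1) * f j by rewrite mulr_ge0// powR_ge0.
  have x01 : 0 <= t w `^ (-1) * f j <= 1.
    by rewrite x0 tV mulrC ler_pdivrMr// mul1r ft.
  have -> : f j `^ p = t w `^ p * (t w `^ (-1) * f j) `^ p.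
    by rewrite -powRM ?(ltW t0)// tV mulrA mulfV ?gt_eqF// mul1r.
  apply: cvgM; first exact: cvg_cst.
  apply: (@bernstein_cvg R (fun y => y `^ p) _ x01) => [y /andP[y0 y1]|e e0].
    rewrite ger0_norm ?powR_ge0//; have := @ge0_ler_powR R p p0 y 1.
    by rewrite powR1; apply; rewrite ?nnegrE.
  have [dl dl0 near] := powR_near p0 x0 e0.
  by exists dl => // y /andP[y0 _]; exact: near.
move=> i j; split.
  apply: (measurable_fun_cvg (h := fun k w => complex.Re (B k w i j))) => [k|w _].
    by have [] := mB k i j.
  have [V _ [u [f [-> Bu uf]]]] := cvgB w.
  rewrite Re_spectral_mx; under eq_fun do rewrite Bu Re_spectral_mx.
  exact: cvg_linear_comb.
apply: (measurable_fun_cvg (h := fun k w => complex.Im (B k w i j))) => [k|w _].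
  by have [] := mB k i j.
have [V _ [u [f [-> Bu uf]]]] := cvgB w.
rewrite Im_spectral_mx; under eq_fun do rewrite Bu Im_spectral_mx.
exact: cvg_linear_comb.
Qed.

End MeasurablePowers.

(** * The scalar inequality *)

Section ScalarBound.
Variables (R : realType) (alpha beta : R).
Hypotheses (alpha01 : 0 <= alpha <= 1) (beta01 : 0 <= beta <= 1).

Lemma gfun_neq0E t : t != 0 -> gfun alpha beta t =
  (expR (alpha * t / 2) - expR (- beta * t / 2)) / (expR (t / 2) - expR (- t / 2)).
Proof. by move=> t0; rewrite /gfun (negbTE t0). Qed.

Lemma sinh_neq0 (t : R) : t != 0 -> expR (t / 2) - expR (- t / 2) != 0.
Proof.
move=> t0; rewrite subr_eq0; apply: contra t0 => /eqP/expR_inj tt.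
by apply/eqP; lra.
Qed.

Lemma gfun_norm_le1 t : t != 0 -> `|gfun alpha beta t| <= 1.
Proof.
move=> t0; rewrite gfun_neq0E// normrM normfV ler_pdivrMr ?normr_gt0 ?sinh_neq0//.
rewrite mul1r; move: alpha01 beta01 => /andP[a0 a1] /andP[b0 b1].
have [tn|tp] : t < 0 \/ 0 < t by move: t0; rewrite neq_lt => /orP.
  rewrite [leRHS]ltr0_norm ?subr_lt0 ?ltr_expR; last by lra.
  rewrite ler0_norm ?subr_le0 ?ler_expR; last by nra.
  have : expR (t / 2) <= expR (alpha * t / 2) by rewrite ler_expR; nra.
  have : expR (- beta * t / 2) <= expR (- t / 2) by rewrite ler_expR; nra.
  lra.
rewrite [leRHS]gtr0_norm ?subr_gt0 ?ltr_expR; last by lra.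
rewrite ger0_norm ?subr_ge0 ?ler_expR; last by nra.
have : expR (alpha * t / 2) <= expR (t / 2) by rewrite ler_expR; nra.
have : expR (- t / 2) <= expR (- beta * t / 2) by rewrite ler_expR; nra.
lra.
Qed.

Lemma gfun_ge_half : alpha = 1 \/ beta = 1 ->
  exists2 t, t != 0 & 2^-1 <= gfun alpha beta t.
Proof.
move: alpha01 beta01 => /andP[a0 a1] /andP[b0 b1].
have e2 : 2 <= expR 1 :> R by have := expR_ge1Dx (1 : R); lra.
have em : expR (-1) < expR 1 :> R by rewrite ltr_expR; lra.
have ep := expR_gt0 (-1 : R).
case=> [-> |->].
  exists 2; first by rewrite pnatr_eq0.
  rewrite /gfun pnatr_eq0/= mul1r divff ?pnatr_eq0//.
  rewrite (_ : - beta * 2 / 2 = - beta); last by lra.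
  rewrite (_ : - 2 / 2 = - 1 :> R); last by lra.
  rewrite ler_pdivlMr ?subr_gt0//.
  have : expR (- beta) <= 1 by rewrite -[leRHS]expR0 ler_expR; lra.
  lra.
exists (-2); first by rewrite oppr_eq0 pnatr_eq0.
rewrite /gfun oppr_eq0 pnatr_eq0/= opprK divff ?pnatr_eq0//.
rewrite (_ : alpha * (-2) / 2 = - alpha); last by lra.
rewrite (_ : -1 * (-2) / 2 = 1 :> R); last by lra.
rewrite (_ : - 2 / 2 = - 1 :> R); last by lra.
rewrite -[in leRHS]opprB -[X in _ / X]opprB invrN mulrNN.
rewrite ler_pdivlMr ?subr_gt0//.
have : expR (- alpha) <= 1 by rewrite -[leRHS]expR0 ler_expR; lra.
lra.
Qed.

(** For a, b > 0 the left-hand side is exactly g(t) (a - b) at t = ln (a / b).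
    When a or b vanishes it is either 0 or, if beta = 1 or alpha = 1, equal to
    a - b up to sign, and g then reaches 1 / 2 somewhere; the factor 2 between
    the two constants absorbs this. *)
Lemma heinz_scalar_bound (K a b : R) :
  (forall t, t != 0 -> `|gfun alpha beta t| <= K / 2) -> 0 <= a -> 0 <= b ->
  `|a `^ ((1 + alpha) / 2) * b `^ ((1 - alpha) / 2)
    - a `^ ((1 - beta) / 2) * b `^ ((1 + beta) / 2)| <= K * `|a - b|.
Proof.
move=> gK; have K0 : 0 <= K.
  by have := gK 1 (oner_neq0 _); have := normr_ge0 (gfun alpha beta 1); lra.
have K1 : alpha = 1 \/ beta = 1 -> 1 <= K.
  move=> /gfun_ge_half[t t0 gt]; have := gK t t0.
  by have := ler_norm (gfun alpha beta t); lra.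
move: alpha01 beta01 => /andP[a0 a1] /andP[b0 b1].
have ap : (1 + alpha) / 2 != 0 by apply: lt0r_neq0; lra.
have bp : (1 + beta) / 2 != 0 by apply: lt0r_neq0; lra.
rewrite le_eqVlt => /predU1P[<-|ap0].
  rewrite (powR0 ap) mul0r !sub0r !normrN => b_ge0.
  have [b1'|b1'] := eqVneq beta 1.
    rewrite b1' subrr mul0r powRr0 mul1r (_ : (1 + 1) / 2 = 1); last by lra.
    by rewrite powRr1// ler_peMl// K1//; right.
  rewrite powR0 ?mul0r ?normr0 ?mulr_ge0//; apply: contra b1' => /eqP ?.
  by apply/eqP; lra.
rewrite le_eqVlt => /predU1P[<-|bp0].
  rewrite (powR0 bp) mulr0 !subr0.
  have [b1'|b1'] := eqVneq alpha 1.
    rewrite b1' subrr mul0r powRr0 mulr1 (_ : (1 + 1) / 2 = 1); last by lra.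
    by rewrite powRr1 ?(ltW ap0)// ler_peMl// K1//; left.
  rewrite powR0 ?mulr0 ?normr0 ?mulr_ge0//; apply: contra b1' => /eqP ?.
  by apply/eqP; lra.
set x := ln a; set y := ln b.
have [ax bx] : a = expR x /\ b = expR y by rewrite !lnK.
rewrite /powR !gt_eqF// -/x -/y -!expRD.
have [xy|xy] := eqVneq x y.
  rewrite xy (_ : _ + _ = y); last by lra.
  rewrite (_ : (1 - beta) / 2 * y + _ = y); last by lra.
  by rewrite subrr normr0 mulr_ge0.
have t0 : x - y != 0 by rewrite subr_eq0.
have E u v : (expR u - expR v) =
    expR ((x + y) / 2) * (expR (u - (x + y) / 2) - expR (v - (x + y) / 2)).
  by rewrite mulrBr -!expRD !subrKC.
rewrite [X in `|X| <= _]E ax bx (E x y) !normrM mulrCA.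
apply: ler_wpM2l => //.
have := gK _ t0; rewrite gfun_neq0E// normrM normfV.
rewrite ler_pdivrMr ?normr_gt0 ?sinh_neq0//.
rewrite (_ : x - (x + y) / 2 = (x - y) / 2); last by lra.
rewrite (_ : y - (x + y) / 2 = - (x - y) / 2); last by lra.
rewrite (_ : _ - (x + y) / 2 = alpha * (x - y) / 2); last by lra.
rewrite (_ : _ - (x + y) / 2 = - beta * (x - y) / 2); last by lra.
move=> /le_trans; apply; apply: ler_wpM2r => //; lra.
Qed.

End ScalarBound.

(** * Comparison of the two tensors *)

Section HeinzTensors.
Local Open Scope complex_scope.
Local Open Scope sesquilinear_scope.
Variables (R : realType) (N : nat) (I : 'I_N -> nat).
Local Notation D := (\prod_(k < N) I k)%N.

Lemma tnorm_frobenius (X : tensor R I I) : (0 < D)%N ->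
  let t := complex.Re (\tr ((tmx X)^t* *m tmx X)) in
  tnorm X ^+ 2 <= t <= D%:R * tnorm X ^+ 2.
Proof. by move=> D_gt0; exact: (tnorm_trace X 1 D_gt0). Qed.

(** The Frobenius norm lies between the spectral norm and sqrt D times it. *)
Lemma tnorm_multiplier (Y Z : tensor R I I) U V (r : 'I_D -> 'I_D -> R) K :
  (0 < D)%N -> 0 <= K -> U \is unitarymx -> V \is unitarymx ->
  (forall i j, (U^t* *m tmx Z *m V) i j = (r i j)%:C * (U^t* *m tmx Y *m V) i j) ->
  (forall i j, `|r i j| <= K) ->
  tnorm Z <= K * Num.sqrt D%:R * tnorm Y.
Proof.
move=> D_gt0 K0 Uu Vu ZY rK.
have := mxtrace_gram_multiplier Uu Vu ZY rK.
have /andP[Zt _] := tnorm_frobenius Z D_gt0.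
have /andP[_ Yt] := tnorm_frobenius Y D_gt0.
move: Zt Yt; move: (\tr _) (\tr _) => [z z'] [y y'] /= Zt Yt.
rewrite lecE => /andP[_] /=; rewrite mul0r subr0 => frob.
rewrite -(@ler_pXn2r _ 2)// ?nnegrE ?tnorm_ge0//; last first.
  by rewrite !mulr_ge0 ?sqrtr_ge0 ?tnorm_ge0.
rewrite !exprMn sqr_sqrtr// -mulrA.
by apply: le_trans Zt (le_trans frob _); apply: ler_wpM2l; rewrite ?exprn_ge0.
Qed.

Lemma spectral_sandwich n (U V M : 'M[R[i]]_n) f g i j :
  U \is unitarymx -> V \is unitarymx ->
  (U^t* *m (spectral_mx U f *m M *m spectral_mx V g) *m V) i j
  = (f i * g j)%:C * (U^t* *m M *m V) i j.
Proof.
move=> Uu Vu.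
rewrite (_ : U^t* *m _ *m V = diag_mx (\row_j (f j)%:C) *m (U^t* *m M *m V)
    *m diag_mx (\row_j (g j)%:C)); last first.
  rewrite /spectral_mx -!mulmxA (unitary_mulVmx Vu) mulmx1.
  by rewrite (mulmxA _ U) (unitary_mulVmx Uu) mul1mx !mulmxA.
rewrite mul_mx_diag mxE mul_diag_mx [X in X * _]mxE !mxE rmorphM.
by rewrite mulrAC.
Qed.

(** In eigenbases of A and B, the entries of A^s X B^t are those of X times
    powers of the eigenvalues a of A^m and b of B^n. So the tensor on the left is
    an entrywise multiple of A^m X - X B^n, with the multipliers estimated in
    heinz_scalar_bound. *)
Lemma heinz_tensor_bound (A B X : tensor R I I) (alpha beta K : R) (m n : nat) :
  (0 < D)%N -> hermitian_tensor A -> hermitian_tensor B ->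
  (forall a, teigenvalue A a -> 0 <= a) -> (forall b, teigenvalue B b -> 0 <= b) ->
  0 <= alpha <= 1 -> 0 <= beta <= 1 ->
  (forall t, t != 0 -> `|gfun alpha beta t| <= K / 2) ->
  tnorm (tsub (einstein (einstein (tpow A (m%:R * (1 + alpha) / 2)) X)
                     (tpow B (n%:R * (1 - alpha) / 2)))
           (einstein (einstein (tpow A (m%:R * (1 - beta) / 2)) X)
                     (tpow B (n%:R * (1 + beta) / 2))))
  <= K * Num.sqrt D%:R *
    tnorm (tsub (einstein (tpow A m%:R) X) (einstein X (tpow B n%:R))).
Proof.
move=> D_gt0 /hermitian_tensorP hA /hermitian_tensorP hB A0 B0 a01 b01 gK.
have [U Uu [lam AE]] := hermitian_spectral hA.
have [V Vu [mu BE]] := hermitian_spectral hB.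
have K0 : 0 <= K.
  by have := gK 1 (oner_neq0 _); have := normr_ge0 (gfun alpha beta 1); lra.
pose q i j := (lam i `^ m%:R) `^ ((1 + alpha) / 2) * (mu j `^ n%:R) `^ ((1 - alpha) / 2)
  - (lam i `^ m%:R) `^ ((1 - beta) / 2) * (mu j `^ n%:R) `^ ((1 + beta) / 2).
pose p i j := lam i `^ m%:R - mu j `^ n%:R.
have qp i j : `|q i j| <= K * `|p i j|.
  exact: (heinz_scalar_bound a01 b01 gK (powR_ge0 _ _) (powR_ge0 _ _)).
pose r i j := q i j / p i j.
have rE i j : q i j = r i j * p i j.
  have [p0|p0] := eqVneq (p i j) 0; last by rewrite /r divfK.
  have := qp i j; rewrite p0 normr0 mulr0 normr_le0 => /eqP ->.
  by rewrite mulr0.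
have rK i j : `|r i j| <= K.
  have [p0|p0] := eqVneq (p i j) 0; first by rewrite /r p0 invr0 mulr0 normr0.
  by rewrite /r normrM normfV ler_pdivrMr ?normr_gt0.
have sandwichB i j (M M' : 'M[R[i]]_D) : (U^t* *m (M - M') *m V) i j
    = (U^t* *m M *m V) i j - (U^t* *m M' *m V) i j.
  by rewrite mulmxBr mulmxBl mxE [X in _ + X]mxE.
apply: (tnorm_multiplier D_gt0 K0 Uu Vu _ rK) => i j.
pose F s := spectral_mx U (fun i => lam i `^ s).
pose G s := spectral_mx V (fun j => mu j `^ s).
have FE s : tmx (tpow A s) = F s := tmx_tpow s Uu AE.
have GE s : tmx (tpow B s) = G s := tmx_tpow s Vu BE.
have FXG s t : (U^t* *m (F s *m tmx X *m G t) *m V) i j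
    = (lam i `^ s * mu j `^ t)%:C * (U^t* *m tmx X *m V) i j.
  exact: spectral_sandwich.
have FX s : (U^t* *m (F s *m tmx X) *m V) i j
    = (lam i `^ s)%:C * (U^t* *m tmx X *m V) i j.
  have := FXG s 0; rewrite powRr0 mulr1 => <-.
  have -> : G 0 = 1%:M.
    rewrite -(spectral_mx1 Vu); congr spectral_mx; apply/funext => l.
    by rewrite powRr0.
  by rewrite mulmx1.
have XG t : (U^t* *m (tmx X *m G t) *m V) i j
    = (mu j `^ t)%:C * (U^t* *m tmx X *m V) i j.
  have := FXG 0 t; rewrite powRr0 mul1r => <-.
  have -> : F 0 = 1%:M.
    rewrite -(spectral_mx1 Uu); congr spectral_mx; apply/funext => l.
    by rewrite powRr0.
  by rewrite mul1mx.
clearbody F G.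
have sub M M' a b : (U^t* *m M *m V) i j = a%:C * (U^t* *m tmx X *m V) i j ->
    (U^t* *m M' *m V) i j = b%:C * (U^t* *m tmx X *m V) i j ->
    (U^t* *m (M - M') *m V) i j = (a - b)%:C * (U^t* *m tmx X *m V) i j.
  by move=> Ma M'b; rewrite sandwichB Ma M'b -mulrBl -rmorphB.
rewrite !tmx_tsub !tmx_einstein !FE !GE.
refine (etrans (sub _ _ _ _ (FXG _ _) (FXG _ _)) _).
refine (etrans _ (congr1 _ (esym (sub _ _ _ _ (FX _) (XG _))))).
by rewrite mulrA -rmorphM -/(p i j) -rE /q -!powRrM !mulrA.
Qed.

(** This turns the event into countably many polynomial conditions on the
    entries. By tnorm_trace the k-th condition gives D (tnorm Z)^(2k) >=
    theta^(2k), and the dimension D is negligible as k grows. *)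
Lemma tnorm_geP (Z : tensor R I I) (theta : R) : (0 < D)%N -> 0 < theta ->
  theta <= tnorm Z <->
  forall k, theta ^+ (2 * k) <= complex.Re (\tr (((tmx Z)^t* *m tmx Z) ^+ k)).
Proof.
move=> D_gt0 theta0; have Z0 := tnorm_ge0 Z D_gt0; split=> [le k|le].
  have /andP[+ _] := tnorm_trace Z k D_gt0; apply: le_trans.
  by apply: lerXn2r; rewrite ?nnegrE ?(ltW theta0).
rewrite leNgt; apply/negP => lt.
pose x := (tnorm Z / theta) ^+ 2.
have x0 : 0 <= x by rewrite exprn_ge0// divr_ge0// ltW.
have x1 : `|x| < 1.
  rewrite ger0_norm// /x expr_lt1//; first by rewrite ltr_pdivrMr// mul1r.
  by rewrite divr_ge0// ltW.
have D0 : 0 < D%:R :> R by rewrite ltr0n.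
have /cvgrPdist_lt/(_ D%:R^-1) := cvg_expr x1; rewrite invr_gt0 => /(_ D0).
move=> [k _ /(_ k (leqnn k))] /=; rewrite sub0r normrN ger0_norm ?exprn_ge0//.
rewrite /x -exprM expr_div_n ltr_pdivrMr ?exprn_gt0// mulrC.
rewrite ltr_pdivlMr// mulrC => lt'.
have /andP[_ ub] := tnorm_trace Z k D_gt0.
  by have := le_lt_trans (le_trans (le k) ub) lt'; rewrite ltxx.
by rewrite divr_ge0// ltW.
Qed.

Variables (d : measure_display) (T : measurableType d).

Lemma random_tensorP (A : T -> tensor R I I) :
  random_tensor A <-> mxmeasurable (fun w => tmx (A w)).
Proof.
split=> [mA i j|mA [p q]].
  by under eq_fun do rewrite mxE; exact: mA.
have := mA (ord_of_midx p) (ord_of_midx q).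
by under eq_fun do rewrite mxE !ord_of_midxK.
Qed.

Lemma mxmeasurable_tpow (A : T -> tensor R I I) p : 0 <= p ->
  random_tensor A -> (forall w, hermitian_tensor (A w)) ->
  (forall w a, teigenvalue (A w) a -> 0 <= a) ->
  mxmeasurable (fun w => tmx (tpow (A w) p)).
Proof.
move=> p0 /random_tensorP mA hA A0; apply: (mxmeasurable_powR p0 mA) => w.
have [V Vu [f AE]] := hermitian_spectral ((hermitian_tensorP _).1 (hA w)).
exists V => //; exists f; first exact: tspectral_ge0 Vu AE (A0 w).
by split => //; exact: tmx_tpow.
Qed.

Lemma measurable_tnorm_ge (Z : T -> tensor R I I) theta : (0 < D)%N -> 0 < theta ->
  mxmeasurable (fun w => tmx (Z w)) ->
  measurable [set w | theta <= tnorm (Z w)].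
Proof.
move=> D_gt0 theta0 mZ.
rewrite (_ : [set _ | _] = \bigcap_k [set w | theta ^+ (2 * k) <=
    complex.Re (\tr (((tmx (Z w))^t* *m tmx (Z w)) ^+ k))]); last first.
  apply/seteqP; split => w /=.
    by move=> /(tnorm_geP _ D_gt0 theta0) le k _ /=; exact: le.
  by move=> le; apply/(tnorm_geP _ D_gt0 theta0) => k; exact: le.
apply: bigcap_measurable => // k _; rewrite -[X in measurable X]setTI.
apply: measurable_fun_le => //.
by have [] := cmeasurable_mxtrace (mxmeasurableX k
  (mxmeasurableM (mxmeasurable_adj mZ) mZ)).
Qed.

End HeinzTensors.

(** * A pointwise bound from the L2 norms of a function and its derivative *)

Lemma open_punctured (R : realType) : open (~` [set (0 : R)]).
Proof.
exact/closed_openC/accessible_closed_set1/hausdorff_accessible/Rhausdorff.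
Qed.

Section Agmon.
Variable R : realType.
Implicit Types f : R -> R.
Local Notation mu := (@lebesgue_measure R).

Lemma measurable_punctured f :
  (forall t, t != 0 -> {for t, continuous f}) -> measurable_fun [set: R] f.
Proof.
move=> cf; rewrite -(setUv [set (0 : R)]); apply/measurable_funU => //.
  exact: measurableC.
split; first exact: measurable_fun_set1.
apply: open_continuous_measurable_fun; first exact: open_punctured.
by move=> x; rewrite inE => /eqP; exact: cf.
Qed.

Lemma L2norm_sqr f : (L2norm f `^ 2 = \int[mu]_x (`|f x| ^+ 2)%:E)%E.
Proof.
rewrite /L2norm poweR_Lnorm//; apply: eq_integral => x _ /=.
by rewrite -powR_mulrn.
Qed.

(** Otherwise the integral of f^2 over A would be at least e times mu A. *)
Lemma L2norm_small f (A : set R) e : measurable_fun [set: R] f ->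
  (L2norm f < +oo)%E -> measurable A -> mu A = +oo%E -> 0 < e ->
  exists2 x, A x & f x ^+ 2 < e.
Proof.
move=> mf foo mA muA e0; apply: contrapT => /forall2NP nf.
have mf2 : measurable_fun [set: R] (fun x => (`|f x| ^+ 2)%:E).
  by apply/measurable_EFinP/measurable_funX; exact: measurableT_comp.
have : (\int[mu]_(x in A) e%:E <= \int[mu]_x (`|f x| ^+ 2)%:E)%E.
  apply: (@le_trans _ _ (\int[mu]_(x in A) (`|f x| ^+ 2)%:E)%E).
    apply: ge0_le_integral => //.
    - by move=> x _; rewrite lee_fin ltW.
    - exact: measurable_funTS.
    - move=> x Ax; rewrite lee_fin real_normK ?num_real//.
      by case: (nf x) => // /negP; rewrite -leNgt.
  by apply: ge0_subset_integral => // x _; rewrite lee_fin exprn_ge0.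
have -> : (\int[mu]_(x in A) e%:E = e%:E * mu A)%E by exact: integral_cst.
rewrite muA gt0_muley ?lte_fin// leye_eq => /eqP int_oo.
have := poweR_lty 2 foo.
by rewrite L2norm_sqr int_oo ltxx.
Qed.

(** The derivative of f^2 is 2 f f', whose integral over any interval is
    controlled by the Cauchy-Schwarz inequality. From t, integrate in the
    direction leading away from 0, up to a point where f is small: the origin,
    where nothing is known of f, is never crossed. *)
Lemma agmon f : (forall t, t != 0 -> derivable f t 1) ->
  (forall t, t != 0 -> {for t, continuous (derive1 f)}) ->
  (L2norm f < +oo)%E -> (L2norm (derive1 f) < +oo)%E ->
  forall t, t != 0 ->
  f t ^+ 2 <= 2 * (fine (L2norm f) * fine (L2norm (derive1 f))).
Proof.
move=> df cf' foo f'oo.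
have cf t : t != 0 -> {for t, continuous f}.
  by move=> t0; exact/differentiable_continuous/derivable1_diffP/df.
have mf := measurable_punctured cf; have mf' := measurable_punctured cf'.
have mff' := measurable_funM mf mf'.
set C := fine _ * fine _.
have ff'C : (\int[mu]_x `|(f x * derive1 f x)%:E| <= C%:E)%E.
  have := hoelder mu mf mf' (ltr0n R 2) (ltr0n R 2).
  rewrite Lnorm1 /C EFinM !fineK ?ge0_fin_numE ?Lnorm_ge0//; apply.
  by lra.
pose h x := 2 * (f x * derive1 f x).
have oscillation a b : a < b -> ~~ (a <= 0 <= b) ->
    `|f b ^+ 2 - f a ^+ 2| <= 2 * C.
  move=> ab ab0.
  have ne0 x : a <= x -> x <= b -> x != 0.
    by move=> ax xb; apply: contraNneq ab0 => <-; rewrite ax xb.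
  have ch x : a <= x -> x <= b -> {for x, continuous h}.
    move=> ax xb; have x0 := ne0 x ax xb.
    apply: continuousM; first exact: cvg_cst.
    by apply: continuousM; [exact: cf|exact: cf'].
  have dF x : a <= x -> x <= b -> is_derive x 1 (fun x => f x ^+ 2) (h x).
    move=> ax xb; have x0 := ne0 x ax xb; have dfx := df x x0.
    have dfx' : is_derive x 1 f (derive1 f x) by rewrite derive1E; exact: DeriveDef.
    rewrite (_ : (fun x => f x ^+ 2) = f * f); last first.
      by apply/funext => y; rewrite expr2.
    rewrite (_ : h x = f x *: derive1 f x + f x *: derive1 f x).
      exact: is_deriveM.
    by rewrite /h /GRing.scale/=; ring.
  have FTC : (\int[mu]_(x in `[a, b]) (h x)%:E = (f b ^+ 2)%:E - (f a ^+ 2)%:E)%E.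
    have cF x : a <= x -> x <= b -> {for x, continuous (fun x => f x ^+ 2)}.
      move=> ax xb; apply/differentiable_continuous/derivable1_diffP.
      by have [] := dF x ax xb.
    apply: (@continuous_FTC2 R h (fun x => f x ^+ 2) a b ab).
    - apply: continuous_in_subspaceT => x; rewrite inE/= in_itv/= => /andP[].
      exact: ch.
    - split.
      + move=> x; rewrite in_itv/= => /andP[ax xb].
        by have [] := dF x (ltW ax) (ltW xb).
      + by apply: cvg_at_right_filter; apply: cF => //; exact: ltW.
      + by apply: cvg_at_left_filter; apply: cF => //; exact: ltW.
    - move=> x; rewrite in_itv/= => /andP[ax xb].
      by rewrite derive1E; have [_ ->] := dF x (ltW ax) (ltW xb).
  rewrite -lee_fin -[leLHS]/(`|(f b ^+ 2 - f a ^+ 2)%:E|)%E EFinB -FTC.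
  have mh : measurable_fun [set: R] h by exact: measurable_funM.
  have mhE : measurable_fun [set: R] (fun x => (h x)%:E) by exact/measurable_EFinP.
  apply: le_trans (le_abse_integral _ _ _) _ => //; first exact: measurable_funTS.
  apply: (@le_trans _ _ (\int[mu]_x `|(h x)%:E|)%E).
    by apply: ge0_subset_integral => //; exact: measurableT_comp.
  rewrite (_ : (fun x => _) = fun x => (2%:E * `|(f x * derive1 f x)%:E|)%E); last first.
    by apply/funext => x; rewrite /h /= normrM ger0_norm// EFinM.
  rewrite ge0_integralZl//; last first.
    by apply: measurableT_comp => //; exact/measurable_EFinP.
  by rewrite EFinM lee_pmul2l.
move=> t t0; apply/ler_addgt0Pr => e e0.
have [T [Tt Te]] : exists T, f T ^+ 2 < e /\ `|f t ^+ 2 - f T ^+ 2| <= 2 * C.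
  have [tn|tp] : t < 0 \/ 0 < t by move: t0; rewrite neq_lt => /orP.
    have [||T /= + Te] := L2norm_small (A := `]-oo, t[) mf foo _ _ e0 => //.
      by rewrite lebesgue_measure_itv/= ltNyr.
    rewrite in_itv/= => Tt; exists T; split => //.
    by apply: oscillation => //; rewrite negb_and -!ltNge tn orbT.
  have [||T /= + Te] := L2norm_small (A := `]t, +oo[) mf foo _ _ e0 => //.
    by rewrite lebesgue_measure_itv/= ltry.
  rewrite in_itv/= andbT => Tt; exists T; split => //; rewrite distrC.
  by apply: oscillation => //; rewrite negb_and -!ltNge tp.
have := ler_norm (f t ^+ 2 - f T ^+ 2); lra.
Qed.

End Agmon.

Section KernelRegularity.
Variables (R : realType) (alpha beta : R).

(** Numerator and denominator of the kernel, with each exponent written as a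
    constant times t. *)
Definition gnum (t : R) := expR (alpha / 2 * t) - expR (- beta / 2 * t).
Definition gden (t : R) := expR (2^-1 * t) - expR (- 2^-1 * t).

Lemma near_neq0 (s : R) : s != 0 -> \forall x \near s, x != 0.
Proof.
move=> /eqP s0.
have U : nbhs s (~` [set (0 : R)]).
  by apply: open_nbhs_nbhs; split => //; exact: open_punctured.
by apply: filterS U => x /eqP.
Qed.

Lemma is_derive_expRM (c t : R) :
  is_derive t 1 (fun x => expR (c * x)) (c * expR (c * t)).
Proof.
have dc : is_derive t 1 (fun x : R => c * x) c.
  by apply: is_derive_eq; rewrite /GRing.scale/= mulr1.
by have := is_derive1_comp (is_derive_expR (c * t)) dc; rewrite mulrC.
Qed.

Lemma gfun_smooth t : t != 0 -> derivable (gfun alpha beta) t 1 /\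
  {for t, continuous (derive1 (gfun alpha beta))}.
Proof.
pose num' (t : R) :=
  alpha / 2 * expR (alpha / 2 * t) - (- beta / 2) * expR (- beta / 2 * t).
pose den' (t : R) := 2^-1 * expR (2^-1 * t) - (- 2^-1) * expR (- 2^-1 * t).
pose dg t := num' t * (gden t)^-1 + gnum t * (- (gden t) ^- 2 * den' t).
have den0 (s : R) : s != 0 -> gden s != 0.
  move=> s0; rewrite /gden subr_eq0; apply: contra s0 => /eqP/expR_inj ss.
  by apply/eqP; lra.
have near0 (s : R) : s != 0 -> \forall x \near s,
    gnum x * (gden x)^-1 = gfun alpha beta x.
  move=> s0; near=> x; rewrite /gfun ifF; last first.
    by apply/negbTE; near: x; exact: near_neq0.
  rewrite /gnum /gden; congr ((expR _ - expR _) / (expR _ - expR _)); lra.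
have dnum (s : R) : is_derive s 1 gnum (num' s).
  exact: (is_deriveB (is_derive_expRM _ _) (is_derive_expRM _ _)).
have dden (s : R) : is_derive s 1 gden (den' s).
  exact: (is_deriveB (is_derive_expRM _ _) (is_derive_expRM _ _)).
have dgfun (s : R) : s != 0 -> is_derive s 1 (gfun alpha beta) (dg s).
  move=> s0; apply: near_eq_is_derive (near0 s s0) _.
  have D := is_deriveM (dnum s) (is_deriveV (den0 s s0) (dden s)).
  by rewrite /dg addrC [num' s * _]mulrC; exact: D.
move=> t0; split; first by have [] := dgfun t t0.
have cE c : continuous (fun x : R => expR (c * x)).
  move=> x; apply/differentiable_continuous/derivable1_diffP.
  by have [] := is_derive_expRM c x.
have cdg : {for t, continuous dg}.
  have cnum : {for t, continuous gnum} by apply: continuousB; exact: cE.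
  have cden : {for t, continuous gden} by apply: continuousB; exact: cE.
  have cnum' : {for t, continuous num'}.
    by apply: continuousB; apply: continuousM; try exact: cE; exact: cvg_cst.
  have cden' : {for t, continuous den'}.
    by apply: continuousB; apply: continuousM; try exact: cE; exact: cvg_cst.
  apply: continuousD; apply: continuousM => //.
    by apply: continuousV => //; exact: den0.
  apply: continuousM => //; apply: continuousN; apply: continuousV.
    by rewrite expf_neq0// den0.
  by apply: continuousM.
have near_t : \forall x \near t, dg x = derive1 (gfun alpha beta) x.
  near=> x; have x0 : x != 0 by near: x; exact: near_neq0.
  by rewrite derive1E; have [_ ->] := dgfun x x0.
have dgt := nbhs_singleton near_t.
apply: (cvg_trans (near_eq_cvg near_t)).
exact: (@eq_ind R (dg t) (fun y => dg x @[x --> t] --> y) cdg _ dgt).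
Unshelve. all: by end_near.
Qed.

End KernelRegularity.

(** * The minimizing constant *)

Section MinimizingConstant.
Variable R : realType.

(** The equality case of the arithmetic-geometric mean inequality, at c = v / u;
    the product of the two coefficients is 2 for every c. *)
Lemma agm_min (u v : R) : 0 <= u -> 0 <= v -> (u == 0) = (v == 0) ->
  (exists2 c, 0 < c &
     Num.sqrt (2 * c) * u + Num.sqrt (2 / c) * v = Num.sqrt (8 * (u * v))) /\
  forall c, 0 < c ->
    Num.sqrt (8 * (u * v)) <= Num.sqrt (2 * c) * u + Num.sqrt (2 / c) * v.
Proof.
move=> u0 v0 uv0.
have E c : 0 < c -> Num.sqrt (2 * c) * Num.sqrt (2 / c) = 2.
  move=> c0; rewrite -sqrtrM; last by rewrite mulr_ge0// ltW.
  by rewrite mulrACA divff ?gt_eqF// mulr1 -expr2 sqrtr_sqr ger0_norm.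
have sqr c : 0 < c -> (Num.sqrt (2 * c) * u + Num.sqrt (2 / c) * v) ^+ 2
    = 8 * (u * v) + (Num.sqrt (2 * c) * u - Num.sqrt (2 / c) * v) ^+ 2.
  move=> c0; have -> : 8 * (u * v) = 4 * (Num.sqrt (2 * c) * Num.sqrt (2 / c)) * (u * v).
    by rewrite E//; ring.
  by ring.
have ge0 c : 0 <= Num.sqrt (2 * c) * u + Num.sqrt (2 / c) * v.
  by rewrite addr_ge0// mulr_ge0// sqrtr_ge0.
split; last first.
  move=> c c0; rewrite -[leRHS]ger0_norm// -sqrtr_sqr ler_wsqrtr// sqr//.
  by rewrite lerDl sqr_ge0.
have [u0'|un0] := eqVneq u 0.
  move: uv0; rewrite u0' eqxx => /esym/eqP ->.
  by exists 1 => //; rewrite !mulr0 addr0 sqrtr0.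
have up : 0 < u by rewrite lt0r un0.
have vp : 0 < v by rewrite lt0r -uv0 un0.
have c0 : 0 < v / u by rewrite divr_gt0.
exists (v / u) => //; rewrite -[LHS]ger0_norm// -sqrtr_sqr sqr//.
suff -> : Num.sqrt (2 * (v / u)) * u = Num.sqrt (2 / (v / u)) * v.
  by rewrite subrr expr0n addr0.
have s0 : Num.sqrt (2 * (v / u)) != 0 by rewrite gt_eqF// sqrtr_gt0 mulr_gt0.
apply: (mulfI s0); rewrite [RHS]mulrA E// [LHS]mulrA -expr2.
have c2 : 0 <= 2 * (v / u) by rewrite mulr_ge0// ltW.
by rewrite sqr_sqrtr// -mulrA divfK.
Qed.

Lemma gfun_eq0 (alpha beta : R) : 0 <= alpha -> 0 <= beta ->
  gfun alpha beta 1 = 0 -> gfun alpha beta = cst 0.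
Proof.
move=> a0 b0; rewrite gfun_neq0E ?oner_neq0// => /eqP.
rewrite mulf_eq0 invr_eq0 (negbTE (sinh_neq0 (oner_neq0 R))) orbF subr_eq0.
move=> /eqP/expR_inj ab; have [a0' b0'] : alpha = 0 /\ beta = 0 by split; lra.
apply/funext => t; rewrite /gfun a0' b0'; case: ifP => _; first by rewrite addr0 mul0r.
by rewrite oppr0 subrr mul0r.
Qed.

Lemma L2norm0 : L2norm (cst 0 : R -> R) = 0%E.
Proof. by rewrite /L2norm; exact: (Lnorm0 _ (p := 2%:E)). Qed.

(** When g or g' is not square integrable every value is infinite. Otherwise
    the minimum is sqrt (8 u v), twice the square root of the bound on g^2; it is
    attained because neither norm vanishes without the other: if u v = 0 then
    g = 0. *)
Lemma heinz_constant (alpha beta : R) :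
  0 <= alpha <= 1 -> 0 <= beta <= 1 ->
  exists2 C : \bar R,
    is_min [set ((Num.sqrt (2 * c))%:E * L2norm (gfun alpha beta)
                 + (Num.sqrt (2 / c))%:E * L2norm (derive1 (gfun alpha beta)))%E
           | c in [set c : R | 0 < c]] C &
    C = +oo%E \/ exists2 K, C = K%:E & forall t, t != 0 -> `|gfun alpha beta t| <= K / 2.
Proof.
move=> a01 b01; set g := gfun alpha beta.
have u_ge0 : (0 <= L2norm g)%E by exact: Lnorm_ge0.
have v_ge0 : (0 <= L2norm (derive1 g))%E by exact: Lnorm_ge0.
have s_gt0 c : 0 < c -> 0 < Num.sqrt (2 * c) :> R /\ 0 < Num.sqrt (2 / c) :> R.
  by move=> c0; rewrite !sqrtr_gt0 mulr_gt0// divr_gt0.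
have infinite : (L2norm g = +oo \/ L2norm (derive1 g) = +oo)%E -> forall c, 0 < c ->
    ((Num.sqrt (2 * c))%:E * L2norm g + (Num.sqrt (2 / c))%:E * L2norm (derive1 g)
     = +oo)%E.
  move=> oo c c0; have [s1 s2] := s_gt0 c c0; case: oo => ->.
    rewrite gt0_muley ?lte_fin// addye// -ltNye.
    by apply: lt_le_trans (ltNyr 0) _; rewrite mule_ge0// lee_fin ltW.
  rewrite [X in (_ + X)%E]gt0_muley ?lte_fin// addey// -ltNye.
  by apply: lt_le_trans (ltNyr 0) _; rewrite mule_ge0// lee_fin ltW.
have [/infinite oo|] := pselect (L2norm g = +oo \/ L2norm (derive1 g) = +oo)%E.
  exists +oo%E; last by left.
  by split; [exists 1; [exact: ltr01|exact: oo ltr01]|move=> _ [c c0 <-]; rewrite oo].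
move=> /not_orP[/eqP uoo /eqP voo].
have ufin : L2norm g \is a fin_num by rewrite ge0_fin_numE// ltey.
have vfin : L2norm (derive1 g) \is a fin_num by rewrite ge0_fin_numE// ltey.
have ag := agmon (fun t t0 => (@gfun_smooth R alpha beta t t0).1)
  (fun t t0 => (@gfun_smooth R alpha beta t t0).2).
have {}ag : forall t, t != 0 ->
    g t ^+ 2 <= 2 * (fine (L2norm g) * fine (L2norm (derive1 g))).
  by apply: ag; rewrite ltey.
set u := fine _ in ag; set v := fine _ in ag.
have u0 : 0 <= u by exact: fine_ge0.
have v0 : 0 <= v by exact: fine_ge0.
have uv0 : (u == 0) = (v == 0).
  have null : u * v = 0 -> u = 0 /\ v = 0.
    move=> uv; have := ag 1 (oner_neq0 _); rewrite uv mulr0 => g1.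
    have g0 : g = cst 0.
      apply: gfun_eq0; [by case/andP: a01|by case/andP: b01|].
      by apply/eqP; rewrite -sqrf_eq0 eq_le g1 sqr_ge0.
    rewrite /u /v g0 L2norm0 (_ : derive1 (cst 0) = cst 0) ?L2norm0//.
    by apply/funext => t; rewrite derive1_cst.
  by apply/eqP/eqP => E; case: null => //; rewrite E ?mul0r ?mulr0.
have [[c c0 Ec] Cmin] := agm_min u0 v0 uv0.
have fineE x : ((Num.sqrt (2 * x))%:E * L2norm g
    + (Num.sqrt (2 / x))%:E * L2norm (derive1 g)
    = (Num.sqrt (2 * x) * u + Num.sqrt (2 / x) * v)%:E)%E.
  by rewrite EFinD !EFinM !fineK.
exists (Num.sqrt (8 * (u * v)))%:E.
  split; first by exists c; [exact: c0|rewrite fineE Ec].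
  by move=> _ [x x0 <-]; rewrite fineE lee_fin Cmin.
right; eexists; first by [].
move=> t t0; have uv : 0 <= u * v by rewrite mulr_ge0.
rewrite -sqrtr_sqr -[leRHS]ger0_norm ?divr_ge0// -[leRHS]sqrtr_sqr ler_wsqrtr//.
rewrite expr_div_n sqr_sqrtr ?mulr_ge0//.
by have := ag t t0; lra.
Qed.

End MinimizingConstant.

(** * Markov's inequality for the spectral norm *)

Section Markov.
Variables (R : realType) (N : nat) (I : 'I_N -> nat).
Local Notation D := (\prod_(k < N) I k)%N.
Variables (d : measure_display) (T : measurableType d) (P : probability T R).

Lemma mxmeasurable_tsub (Y Z : T -> tensor R I I) :
  mxmeasurable (fun w => tmx (Y w)) -> mxmeasurable (fun w => tmx (Z w)) ->
  mxmeasurable (fun w => tmx (tsub (Y w) (Z w))).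
Proof.
move=> mY mZ; have -> : (fun w => tmx (tsub (Y w) (Z w)))
    = fun w => tmx (Y w) - tmx (Z w) by apply/funext => w; exact: tmx_tsub.
exact: mxmeasurableB.
Qed.

Lemma mxmeasurable_einstein (Y Z : T -> tensor R I I) :
  mxmeasurable (fun w => tmx (Y w)) -> mxmeasurable (fun w => tmx (Z w)) ->
  mxmeasurable (fun w => tmx (einstein (Y w) (Z w))).
Proof.
move=> mY mZ; have -> : (fun w => tmx (einstein (Y w) (Z w)))
    = fun w => tmx (Y w) *m tmx (Z w) by apply/funext => w; exact: tmx_einstein.
exact: mxmeasurableM.
Qed.

Lemma measurable_tnorm (Z : T -> tensor R I I) : (0 < D)%N ->
  mxmeasurable (fun w => tmx (Z w)) ->
  measurable_fun [set: T] (fun w => tnorm (Z w)).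
Proof.
move=> D_gt0 mZ mT; apply: (measurability _ (RGenCInfty.measurableE R)) => //.
move=> _ [_ [x ->] <-]; rewrite setTI.
rewrite (_ : _ @^-1` _ = [set w | x <= tnorm (Z w)]); last first.
  by apply/seteqP; split => w /=; rewrite in_itv/= andbT.
have [x0|x0] := ltP 0 x; first exact: measurable_tnorm_ge.
rewrite (_ : [set _ | _] = setT)//; apply/seteqP; split => // w _ /=.
exact: le_trans x0 (tnorm_ge0 _ D_gt0).
Qed.

Lemma markov_tnorm (Y Z : T -> tensor R I I) (L theta : R) : (0 < D)%N ->
  0 < theta -> 0 <= L ->
  mxmeasurable (fun w => tmx (Y w)) -> mxmeasurable (fun w => tmx (Z w)) ->
  (forall w, tnorm (Z w) <= L * tnorm (Y w)) ->
  (P [set w | (theta <= tnorm (Z w))%R]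
   <= (L / theta)%:E * 'E_P[fun w => tnorm (Y w)])%E.
Proof.
move=> D_gt0 theta0 L0 mY mZ ZY.
have mS := measurable_tnorm_ge D_gt0 theta0 mZ.
have mtY := measurable_tnorm D_gt0 mY.
rewrite unlock -ge0_integralZl//=; last 3 first.
- exact/measurable_EFinP.
- by move=> w _; rewrite lee_fin tnorm_ge0.
- by rewrite lee_fin divr_ge0// ltW.
rewrite -[leLHS]mul1e -(integral_cst _ mS).
apply: (@le_trans _ _ (\int[P]_(w in [set w | (theta <= tnorm (Z w))%R])
    ((L / theta)%:E * (tnorm (Y w))%:E))%E).
  apply: ge0_le_integral => //.
  - by apply: emeasurable_funM => //; apply/measurable_funTS/measurable_EFinP.
  - move=> w /= le; rewrite -EFinM lee_fin mulrAC ler_pdivlMr// mul1r.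
    exact: le_trans le (ZY w).
apply: ge0_subset_integral => //.
  by apply: emeasurable_funM => //; apply/measurable_EFinP.
by move=> w _; rewrite -EFinM lee_fin mulr_ge0 ?tnorm_ge0// divr_ge0// ltW.
Qed.

End Markov.

Theorem theorem6 (R : realType) (N : nat) (I : 'I_N -> nat)
    (N_gt0 : (0 < N)%N) (I_gt0 : forall k, (0 < I k)%N)
    (d : measure_display) (Omega : measurableType d) (P : probability Omega R)
    (A B : Omega -> tensor R I I) (X : tensor R I I)
    (A_random : random_tensor A) (B_random : random_tensor B)
    (A_herm : forall w, hermitian_tensor (A w))
    (B_herm : forall w, hermitian_tensor (B w))
    (A_ge0 : forall w a, teigenvalue (A w) a -> 0 <= a)
    (B_ge0 : forall w b, teigenvalue (B w) b -> 0 <= b)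
    (X_herm : hermitian_tensor X)
    (alpha beta : R) (alpha01 : 0 <= alpha <= 1) (beta01 : 0 <= beta <= 1)
    (m n : nat) (m_gt0 : (0 < m)%N) (n_gt0 : (0 < n)%N)
    (theta : R) (theta_gt0 : 0 < theta) :
  exists2 C : \bar R,
    is_min [set ((Num.sqrt (2 * c))%:E * L2norm (gfun alpha beta)
                 + (Num.sqrt (2 / c))%:E * L2norm (derive1 (gfun alpha beta)))%E
           | c in [set c : R | 0 < c]] C &
    (P [set w | (theta <= tnorm (tsub
           (einstein (einstein (tpow (A w) (m%:R * (1 + alpha) / 2)) X)
                     (tpow (B w) (n%:R * (1 - alpha) / 2)))
           (einstein (einstein (tpow (A w) (m%:R * (1 - beta) / 2)) X)
                     (tpow (B w) (n%:R * (1 + beta) / 2)))))%R]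
     <= ((\prod_(k < N) I k)%N%:R ^+ 2 / theta)%:E * C
        * 'E_P[fun w => tnorm (tsub (einstein (tpow (A w) m%:R) X)
                                    (einstein X (tpow (B w) n%:R)))])%E.
Proof.
have [C Cmin CK] := heinz_constant alpha01 beta01; exists C => //.
set D := (\prod_(k < N) I k)%N.
have D_gt0 : (0 < D)%N by rewrite prodn_gt0.
have D2_gt0 : 0 < D%:R ^+ 2 :> R by rewrite exprn_gt0// ltr0n.
have mA s : 0 <= s -> mxmeasurable (fun w => tmx (tpow (A w) s)).
  by move=> s0; exact: mxmeasurable_tpow.
have mB s : 0 <= s -> mxmeasurable (fun w => tmx (tpow (B w) s)).
  by move=> s0; exact: mxmeasurable_tpow.
have mX := mxmeasurable_cst Omega (tmx X).
set E := expectation _ _.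
have E_ge0 : (0 <= E)%E by apply: expectation_ge0 => w; exact: tnorm_ge0.
have bound (K : R) : (forall t, t != 0 -> `|gfun alpha beta t| <= K / 2) ->
    0 <= K /\ (P [set w | (theta <= tnorm (tsub
           (einstein (einstein (tpow (A w) (m%:R * (1 + alpha) / 2)) X)
                     (tpow (B w) (n%:R * (1 - alpha) / 2)))
           (einstein (einstein (tpow (A w) (m%:R * (1 - beta) / 2)) X)
                     (tpow (B w) (n%:R * (1 + beta) / 2)))))%R]
      <= (K * Num.sqrt D%:R / theta)%:E * E)%E.
  move=> gK; have K0 : 0 <= K.
    by have := gK 1 (oner_neq0 _); have := normr_ge0 (gfun alpha beta 1); lra.
  split=> //; apply: markov_tnorm => //.
  - by rewrite mulr_ge0// sqrtr_ge0.
  - by apply: mxmeasurable_tsub; apply: mxmeasurable_einstein => //;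
      [exact: mA|exact: mB].
  - move: alpha01 beta01 => /andP[a0 a1] /andP[b0 b1].
    by apply: mxmeasurable_tsub; (apply: mxmeasurable_einstein;
      [apply: mxmeasurable_einstein => //; apply: mA|apply: mB]);
      rewrite divr_ge0// mulr_ge0//; lra.
  - move=> w; exact: (heinz_tensor_bound _ _ _ D_gt0 (A_herm w) (B_herm w)
      (A_ge0 w) (B_ge0 w) alpha01 beta01 gK).
case: CK => [->|[K -> gK]].
  (* If E = 0 the right-hand side is 0 although C is infinite. The constant 2,
     allowed because |g| <= 1, then shows that the probability vanishes. *)
  have [E0|E0] := eqVneq E 0%E.
    have [t t0|_] := bound 2.
      by rewrite divff// gfun_norm_le1.
    by rewrite E0 !mule0.
  have E_gt0 : (0 < E)%E by rewrite lt0e E0.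
  rewrite [X in (X * E)%E]gt0_muley ?lte_fin ?divr_gt0// gt0_mulye//.
  exact: leey.
have [K0 /le_trans] := bound K gK; apply.
rewrite -EFinM lee_wpmul2r// lee_fin [leRHS]mulrAC.
apply: ler_wpM2r; first by rewrite invr_ge0 ltW.
rewrite mulrC; apply: ler_wpM2r => //.
rewrite (@le_trans _ _ D%:R)//; last first.
  by rewrite -natrX ler_nat -[leqLHS]expn1 leq_pexp2l.
rewrite -[leRHS]ger0_norm// -sqrtr_sqr ler_wsqrtr// -natrX ler_nat.
by rewrite -[leqLHS]expn1 leq_pexp2l.
Qed.
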